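(* Let $\beta\in(0,2)$, $\gamma\in(\beta,2]$, $\lambda\ge 0$, $l>0$ and $\Omega=(-l,l)\times(-l,l)$. Suppose that $u\in C^{2}(\mathbb{R}^2)$ is supported in $\Omega$, i.e. $u(x,y)=0$ for all $(x,y)\notin\Omega$. Then there is a constant $C>0$ (depending on $\beta$ and $\gamma$, as well as on $u,\lambda,l$, but not on $h$) such that for every mesh size $h=2l/N$ with $N\in\mathbb{N}$, $N\ge1$, $$\left\|(\Delta+\lambda)^{\frac{\beta}{2}}u-(\Delta+\lambda)_{h}^{\frac{\beta}{2}}u\right\|_{L_\infty(\Omega)}\leq C\,h^{2-\beta},$$ where $(\Delta+\lambda)^{\beta/2}$ is the two-dimensional tempered fractional Laplacian and $(\Delta+\lambda)_h^{\beta/2}$ is its finite difference approximation, both defined in the context.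
   Context: Tempered fractional Laplacian in two dimensions: $$(\Delta+\lambda)^{\frac{\beta}{2}}u(\mathbf{x})=-c_{2,\beta,\lambda}\,\mathrm{P.V.}\int_{\mathbb{R}^2}\frac{u(\mathbf{x})-u(\mathbf{y})}{e^{\lambda|\mathbf{x}-\mathbf{y}|}|\mathbf{x}-\mathbf{y}|^{2+\beta}}\,d\mathbf{y},$$ where $c_{2,\beta,\lambda}>0$ is a normalization constant depending only on $\beta,\lambda$: for $\lambda>0$, $\beta\ne1$, $c_{2,\beta,\lambda}=\frac{1}{2\pi|\Gamma(-\beta)|}$, and for $\lambda=0$ (fractional Laplacian) it is $c_{2,\beta}=\frac{\beta\,\Gamma(1+\beta/2)}{2^{1-\beta}\pi\,\Gamma(1-\beta/2)}$. P.V. denotes the principal value and $\Gamma$ the Gamma function. $\|v\|_{L_\infty(\Omega)}=\sup_{\Omega}|v|$. Discretization. Let $L=2l$, $N\ge 1$ an integer, $h=L/N$, $\xi_i=ih$, $\eta_j=jh$. For fixed $(x,y)\in\Omega$ and $(\xi,\eta)\in[0,\infty)^2\setminus\{(0,0)\}$ put $$g(x,y,\xi,\eta)=u(x+\xi,y+\eta)+u(x-\xi,y+\eta)+u(x-\xi,y-\eta)+u(x+\xi,y-\eta)-4u(x,y),$$ $$\phi_\gamma(\xi,\eta)=\frac{g(x,y,\xi,\eta)}{e^{\lambda\sqrt{\xi^2+\eta^2}}\left(\sqrt{\xi^2+\eta^2}\right)^{\gamma}}.$$ Let $k_\gamma=1$ if $\gamma\in(\beta,2)$ and $k_\gamma=\frac43$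 if $\gamma=2$, let $$G_{0,0}=\int_0^h\int_0^h(\xi^2+\eta^2)^{\frac{\gamma-2-\beta}{2}}\,d\eta\,d\xi,\qquad G^\infty=\iint_{[0,\infty)^2\setminus[0,L]^2}\frac{d\eta\,d\xi}{e^{\lambda\sqrt{\xi^2+\eta^2}}\left(\sqrt{\xi^2+\eta^2}\right)^{2+\beta}},$$ and for $0\le i,j\le N-1$, $(i,j)\ne(0,0)$, let $$I_{i,j}=\int_{\xi_i}^{\xi_{i+1}}\int_{\eta_j}^{\eta_{j+1}}P_{i,j}(\xi,\eta)\,(\xi^2+\eta^2)^{\frac{\gamma-2-\beta}{2}}\,d\eta\,d\xi,$$ where $P_{i,j}$ is the bilinear interpolant of $\phi_\gamma$ on $[\xi_i,\xi_{i+1}]\times[\eta_j,\eta_{j+1}]$ at the four corners. The finite difference approximation is $$(\Delta+\lambda)_h^{\frac\beta2}u(x,y)=c_{2,\beta,\lambda}\left(\frac{k_\gamma}{4}\big(\phi_\gamma(\xi_0,\eta_1)+\phi_\gamma(\xi_1,\eta_1)+\phi_\gamma(\xi_1,\eta_0)\big)G_{0,0}+\sum_{\substack{0\le i,j\le N-1\\(i,j)\neq(0,0)}}I_{i,j}-4\,u(x,y)\,G^\infty\right).$$ *)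

(* Defs.v *)
From mathcomp Require Import all_boot all_order all_algebra.
From mathcomp Require Import all_classical all_reals all_analysis.

Set Implicit Arguments.
Unset Strict Implicit.
Unset Printing Implicit Defensive.

Import Order.TTheory GRing.Theory Num.Theory.
Import numFieldTopology.Exports numFieldNormedType.Exports.

Local Open Scope classical_set_scope.
Local Open Scope ring_scope.

Definition euler_Gamma {R : realType} (x : R) : R :=
  \int[@lebesgue_measure R]_(t in `]0, +oo[) (t `^ (x - 1) * expR (- t)).

(* For [x <= 0] this is [Gamma (x + n) / (x (x + 1) ... (x + n - 1))], with [n]
   chosen so that [0 < x + n]; it is [0] at the poles [0, -1, -2, ...]. *)
Definition Gamma {R : realType} (x : R) : R :=
  if 0 < x then euler_Gamma x
  else let n := `|Num.floor x|%N.+1 in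
       euler_Gamma (x + n%:R) / \prod_(k < n) (x + k%:R).

Notation lebesgue2 R := (@lebesgue_measure R \x @lebesgue_measure R)%E.

(* The canonical norm of [R * R] is the maximum norm, hence this definition. *)
Definition enorm {R : realType} (p : R * R) : R :=
  Num.sqrt (p.1 ^+ 2 + p.2 ^+ 2).

Fixpoint of_class_C {R : realType} (k : nat) (u : R * R -> R) : Prop :=
  continuous u /\
  if k is k'.+1 then
    [/\ forall p, derivable u p (1, 0),
        forall p, derivable u p (0, 1),
        of_class_C k' ('D_(1, 0) u) &
        of_class_C k' ('D_(0, 1) u)]
  else True.

Definition sup_norm {R : realType} (D : set (R * R)) (v : R * R -> R) : \bar R :=
  ereal_sup [set `|v p|%:E | p in D].

Definition Omega {R : realType} (l : R) : set (R * R) :=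
  `]- l, l[%classic `*` `]- l, l[%classic.

(* No closed form is prescribed when [lambda > 0] and [beta = 1], where
   [Gamma] has a pole at [- beta]: [c] is then any positive number. *)
Definition is_tempered_constant {R : realType} (beta lambda c : R) : Prop :=
  [/\ 0 < c,
      0 < lambda -> beta != 1 -> c = 1 / (2 * pi * `|Gamma (- beta)|) &
      lambda = 0 ->
        c = beta * Gamma (1 + beta / 2) /
            (2 `^ (1 - beta) * pi * Gamma (1 - beta / 2))].

Definition tempered_fraclap {R : realType} (c beta lambda : R)
    (u : R * R -> R) (x : R * R) : R :=
  - c * lim ((fun eps : R =>
      \int[lebesgue2 R]_(y in [set y | eps < enorm (x - y)])
        ((u x - u y) /
         (expR (lambda * enorm (x - y)) * enorm (x - y) `^ (2 + beta))))
    @ 0^'+).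

Definition fd_g {R : realType} (u : R * R -> R) (p q : R * R) : R :=
  u (p.1 + q.1, p.2 + q.2) + u (p.1 - q.1, p.2 + q.2)
  + u (p.1 - q.1, p.2 - q.2) + u (p.1 + q.1, p.2 - q.2) - 4 * u p.

Definition fd_phi {R : realType} (gamma lambda : R) (u : R * R -> R)
    (p q : R * R) : R :=
  fd_g u p q / (expR (lambda * enorm q) * enorm q `^ gamma).

Definition fd_k {R : realType} (gamma : R) : R :=
  if gamma == 2 then 4 / 3 else 1.

Definition fd_weight {R : realType} (beta gamma : R) (q : R * R) : R :=
  (q.1 ^+ 2 + q.2 ^+ 2) `^ ((gamma - 2 - beta) / 2).

Definition fd_G00 {R : realType} (beta gamma h : R) : R :=
  \int[lebesgue2 R]_(q in `[0, h]%classic `*` `[0, h]%classic)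
    fd_weight beta gamma q.

Definition fd_Ginfty {R : realType} (beta lambda L : R) : R :=
  \int[lebesgue2 R]_(q in
      (`[0, +oo[%classic `*` `[0, +oo[%classic) `\`
      (`[0, L]%classic `*` `[0, L]%classic))
    (1 / (expR (lambda * enorm q) * enorm q `^ (2 + beta))).

Definition bilinear_interp {R : realType} (f : R * R -> R) (a b c d : R)
    (q : R * R) : R :=
  (f (a, c) * (b - q.1) * (d - q.2) + f (b, c) * (q.1 - a) * (d - q.2)
   + f (a, d) * (b - q.1) * (q.2 - c) + f (b, d) * (q.1 - a) * (q.2 - c))
  / ((b - a) * (d - c)).

Definition fd_node {R : realType} (h : R) (i : nat) : R := i%:R * h.

Definition fd_I {R : realType} (beta gamma lambda h : R) (u : R * R -> R)
    (p : R * R) (i j : nat) : R :=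
  \int[lebesgue2 R]_(q in
      `[fd_node h i, fd_node h i.+1]%classic `*`
      `[fd_node h j, fd_node h j.+1]%classic)
    (bilinear_interp (fd_phi gamma lambda u p)
       (fd_node h i) (fd_node h i.+1) (fd_node h j) (fd_node h j.+1) q
     * fd_weight beta gamma q).

Definition fd_tempered_fraclap {R : realType}
    (c beta gamma lambda l : R) (N : nat) (u : R * R -> R) (p : R * R) : R :=
  let L := 2 * l in
  let h := L / N%:R in
  let phi := fd_phi gamma lambda u p in
  c * (fd_k gamma / 4
         * (phi (fd_node h 0, fd_node h 1) + phi (fd_node h 1, fd_node h 1)
            + phi (fd_node h 1, fd_node h 0))
         * fd_G00 beta gamma h
       + \sum_(i < N) \sum_(j < N | ~~ ((i == 0 :> nat) && (j == 0 :> nat)))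
           fd_I beta gamma lambda h u p i j
       - 4 * u p * fd_Ginfty beta lambda L).

(* Main.v *)
(* Write [g] for the symmetrised difference [fd_g u p] and
   [K z = exp (- lambda |z|) |z| ^ (- 2 - beta)].  Averaging over the four
   reflections of the plane turns the principal value into the absolutely
   convergent integral of [g K] over the open first quadrant, because
   [|g z| <= 4 M |z|^2] as soon as [M] bounds [u_xx] and [u_yy].
   - Outside [(0, 2 l]^2] one has [g = - 4 u(p)], so this part of the integral is
     reproduced exactly by the term in [fd_Ginfty].
   - On the cell at the origin both the integral and its quadrature are
     [O(h^(2 - beta))], whatever the value of [fd_k gamma] is.
   - On the cell [(i, j) <> (0, 0)] put [m = max(i, j)].  The bilinear
     interpolation error only involves the pure second derivatives of [fd_phi],
     which are [O(|z|^(- gamma))]; multiplied by the weight and by the area [h^2],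
     it contributes [O(h^2 (h m)^(- gamma) (h m)^(gamma - 2 - beta) h^2)], that is
     [O(h^(2 - beta) m^(- 2 - beta))], and this is summable over [(i, j)]. *)
From HB Require Import structures.
Require Import Defs.
From mathcomp Require Import all_boot all_order all_algebra.
From mathcomp Require Import all_classical all_reals all_analysis.
From mathcomp Require Import measurable_realfun ring lra zify.
Import Order.TTheory GRing.Theory Num.Theory.
Import numFieldTopology.Exports numFieldNormedType.Exports.

Local Open Scope classical_set_scope.
Local Open Scope ring_scope.

Set Implicit Arguments.
Unset Strict Implicit.

(** * Interpolation errors in one variable *)

(** The constant has to be uniform in the point [p], so every estimate goes back to one number [M]
    that bounds the pure second derivatives on the square of half-width [3 * l], which contains all
    points that the scheme evaluates. The delicate estimate is that second derivatives of [fd_phi]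
    along a line are no worse than [|z| ^ (- gamma)], although each derivative of the weight costs a
    factor [1 / |z|]. The loss is compensated exactly: along a line the symmetrised difference is
    even up to a shift of height, so it is [O(|z|^2)], its first derivative is [O(|z|)] and its
    second is [O(1)]. As [u] is only of class C^2, all interpolation errors come from repeated mean
    value theorems; the constants are not optimised. A real-valued integral is the finite part of an
    extended one, so it is additive only on integrable functions. The symmetrisation is therefore
    carried out at a fixed cutoff, where the four reflected integrands are separately integrable,
    and the cutoff is removed afterwards with an explicit rate. *)

Lemma MVT_closed (R : realType) (f f' : R -> R) (a b : R) : a <= b ->
  (forall x, a <= x <= b -> is_derive x 1 f (f' x)) ->
  exists2 c, a <= c <= b & f b - f a = f' c * (b - a).
Proof.
move=> ab df.
have [||c cab ->] := @MVT_segment R f f' a b ab.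
- by move=> x; rewrite in_itv/= => /andP[ax xb]; apply: df; rewrite !ltW.
- apply: derivable_within_continuous => x; rewrite in_itv/= => xab.
  by have [] := df x xab.
by exists c.
Qed.

(** The mean value theorem on [[a, x]] and [[x, b]] gives slopes at [c1 <= c2], and applied to [f']
    between them it turns the error into [- f'' c * (c2 - c1) * (b - x) * (x - a) / (b - a)]. The
    crude constant 1 comes from bounding [c2 - c1] and [x - a] by [b - a]. *)
Lemma linear_interp_error (R : realType) (f f' f'' : R -> R) (a b M : R) :
  a < b ->
  (forall x, a <= x <= b -> is_derive x 1 f (f' x)) ->
  (forall x, a <= x <= b -> is_derive x 1 f' (f'' x)) ->
  (forall x, a <= x <= b -> `|f'' x| <= M) ->
  forall x, a <= x <= b ->
  `|f x - (f a * (b - x) + f b * (x - a)) / (b - a)| <= M * (b - a) ^+ 2.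
Proof.
move=> ab df df' M2 x /andP[ax xb].
have [|c1 /andP[ac1 c1x] e1] := @MVT_closed _ f f' a x ax.
  by move=> y /andP[ay yx]; apply: df; rewrite ay (le_trans yx).
have [|c2 /andP[xc2 c2b] e2] := @MVT_closed _ f f' x b xb.
  by move=> y /andP[xy yb]; apply: df; rewrite yb (le_trans ax).
have c12 : c1 <= c2 by apply: le_trans xc2.
have [|c /andP[cc1 cc2] e3] := @MVT_closed _ f' f'' c1 c2 c12.
  by move=> y /andP[? ?]; apply: df'; rewrite (le_trans ac1)//= (le_trans _ c2b).
have hM : `|f'' c| <= M by apply: M2; rewrite (le_trans ac1)//= (le_trans _ c2b).
have M0 : 0 <= M by apply: le_trans hM.
have ba0 : b - a != 0 by rewrite subr_eq0 gt_eqF.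
have -> : f x - (f a * (b - x) + f b * (x - a)) / (b - a) =
   - ((c2 - c1) * ((b - x) / (b - a)) * (x - a)) * f'' c.
  have fb : f b = f a + f' c1 * (x - a) + f' c2 * (b - x) by lra.
  have fx : f x = f a + f' c1 * (x - a) by lra.
  have fc : f' c2 = f' c1 + f'' c * (c2 - c1) by lra.
  by rewrite fb fx fc; field.
rewrite normrM [leRHS]mulrC ler_pM//.
have p0 : 0 <= (b - x) / (b - a) by rewrite divr_ge0// subr_ge0// ltW.
have p1 : (b - x) / (b - a) <= 1.
  by rewrite ler_pdivrMr ?subr_gt0// mul1r lerB.
have hc : 0 <= c2 - c1 by rewrite subr_ge0.
have hx : 0 <= x - a by rewrite subr_ge0.
move: ((b - x) / (b - a)) p0 p1 => p p0 p1.
have hp : 0 <= (c2 - c1) * p by rewrite mulr_ge0.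
have hpx : (c2 - c1) * p <= b - a.
  by apply: le_trans (_ : c2 - c1 <= _); [rewrite ler_piMr|lra].
rewrite normrN ger0_norm; last by rewrite mulr_ge0.
by rewrite expr2 ler_pM//; lra.
Qed.

(** Same scheme: the second difference is [t * (f' c2 - f' c1)] with [c1] and [c2] on either side of
    [x], hence at distance at most [2 * t]. *)
Lemma second_difference_bound (R : realType) (f f' f'' : R -> R) (x t M : R) :
  0 <= t ->
  (forall y, x - t <= y <= x + t -> is_derive y 1 f (f' y)) ->
  (forall y, x - t <= y <= x + t -> is_derive y 1 f' (f'' y)) ->
  (forall y, x - t <= y <= x + t -> `|f'' y| <= M) ->
  `|f (x + t) + f (x - t) - 2 * f x| <= 2 * M * t ^+ 2.
Proof.
move=> t0 df df' M2.
have [||c1 /andP[ac1 c1x] e1] := @MVT_closed _ f f' (x - t) x; first lra.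
  by move=> y yx; apply: df; lra.
have [||c2 /andP[xc2 c2b] e2] := @MVT_closed _ f f' x (x + t); first lra.
  by move=> y yx; apply: df; lra.
have c12 : c1 <= c2 by apply: le_trans xc2.
have [|c /andP[cc1 cc2] e3] := @MVT_closed _ f' f'' c1 c2 c12.
  by move=> y yx; apply: df'; lra.
have hM : `|f'' c| <= M by apply: M2; lra.
have -> : f (x + t) + f (x - t) - 2 * f x = f'' c * ((c2 - c1) * t).
  have fc : f' c2 = f' c1 + f'' c * (c2 - c1) by lra.
  move: e2; rewrite fc => e2; lra.
rewrite normrM [2 * M]mulrC -mulrA ler_pM// ger0_norm ?mulr_ge0//; last lra.
by rewrite expr2 mulrA ler_wpM2r//; lra.
Qed.
(** * Lebesgue measure on the plane *)

(** Measurable sets of the plane are generated by rectangles, so an open set has to be exhibited as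
    a countable union of rectangles, here those with rational corners that it contains. *)
Lemma continuous_measurable_fun2 (R : realType) (u : R * R -> R) :
  continuous u -> measurable_fun setT u.
Proof.
move=> cu; apply: (measurability _ (RGenOpens.measurableE R)).
move=> _ [_ [a [b ->] <-]]; rewrite setTI.
have : open (u @^-1` `]a, b[%classic) by apply: open_comp => //; exact: interval_open.
move: (u @^-1` _) => O oO.
pose rect (q : (rat * rat) * (rat * rat)) : set (R * R) :=
  `]ratr q.1.1, ratr q.1.2[%classic `*` `]ratr q.2.1, ratr q.2.2[%classic.
have itv_nbhs (x : R) (A : set R) : nbhs x A -> exists q1 q2 : rat,
    ratr q1 < x < ratr q2 /\ `]ratr q1, ratr q2[%classic `<=` A.
  move=> /nbhs_ballP[e /= e0 eA].
  have [|q1 q1x] := @rat_in_itvoo R (x - e) x; first lra.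
  have [|q2 q2x] := @rat_in_itvoo R x (x + e); first lra.
  exists q1, q2; move: q1x q2x; rewrite !in_itv/= => /andP[h1 h2] /andP[h3 h4].
  split; [by rewrite h2 h3|] => z/=; rewrite in_itv/= => /andP[h5 h6]; apply: eA.
  by rewrite /ball/= ltr_distlC; lra.
have -> : O = \bigcup_(q in [set q | rect q `<=` O]) rect q.
  apply/seteqP; split => [[x y] Oxy|z [q /= qO /qO]//].
  have [[A B]/= [nA nB] AB] : nbhs (x, y) O by exact: open_nbhs_nbhs.
  have [q1 [q2 [xq qA]]] := itv_nbhs _ _ nA.
  have [q3 [q4 [yq qB]]] := itv_nbhs _ _ nB.
  exists ((q1, q2), (q3, q4)) => //= -[z t] [/= /qA Az /qB Bt].
  exact: AB.
rewrite bigcup_mkcond; apply: countable_bigcupT_measurable => // q.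
by case: ifPn => // _; apply: measurableX; exact: measurable_itv.
Qed.

(** By uniqueness of Lebesgue measure it is enough to compare lengths of half-open intervals. *)
Lemma lebesgue_measure_shift (R : realType) (a : R) (A : set R) : measurable A ->
  pushforward (@lebesgue_measure R) (+%R a : _ -> measurableTypeR R) A =
  lebesgue_measure A.
Proof.
have ms : measurable_fun setT (+%R a : measurableTypeR R -> measurableTypeR R).
  exact: measurable_funD.
move=> mA; apply/esym/lebesgue_measure_unique => //= _ [[x y]] _ <-.
rewrite /pushforward.
have -> : +%R a @^-1` `]x, y] = `](x - a), (y - a)]%classic.
  by apply/seteqP; split => z/=; rewrite !in_itv/=; lra.
rewrite !lebesgue_measure_itv/= !lte_fin ltrD2r.
by case: ifPn => // _; rewrite -!EFinD; congr EFin; lra.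
Qed.
Lemma lebesgue_measureNshift (R : realType) (a : R) (A : set R) : measurable A ->
  lebesgue_measure ((fun x => a - x) @^-1` A) = lebesgue_measure A.
Proof.
move=> mA; rewrite -[RHS](lebesgue_measure_shift a)//.
rewrite -[RHS]lebesgue_measureN//.
by rewrite -[X in measurable X]setTI; exact: measurable_funD.
Qed.

(** By uniqueness of the product measure it is enough to test rectangles, where the claim factors.
    Translations and coordinate reflections of the plane are instances. *)
Lemma lebesgue2_preimage (R : realType) (f g : R -> R) :
  measurable_fun setT f -> measurable_fun setT g ->
  (forall A, measurable A -> lebesgue_measure (f @^-1` A) = lebesgue_measure A) ->
  (forall A, measurable A -> lebesgue_measure (g @^-1` A) = lebesgue_measure A) ->
  forall X : set (R * R), measurable X ->
  (lebesgue2 R) ((fun z => (f z.1, g z.2)) @^-1` X) = (lebesgue2 R) X.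
Proof.
move=> mf mg hf hg X mX.
pose RR := (measurableTypeR R * measurableTypeR R)%type.
have mphi : measurable_fun setT (fun z : RR => (f z.1, g z.2) : RR).
  apply/measurable_fun_pair.
  - exact: (@measurableT_comp _ _ _ _ (measurableTypeR R) _ f).
  - exact: (@measurableT_comp _ _ _ _ (measurableTypeR R) _ g).
pose phi : {mfun RR >-> RR} :=
  HB.pack (fun z : RR => (f z.1, g z.2) : RR) (isMeasurableFun.Build _ _ _ _ _ mphi).
rewrite -[LHS]/(pushforward (lebesgue2 R) phi X).
apply/esym/product_measure_unique => // A B mA mB.
rewrite -[LHS]/((lebesgue2 R) ((f @^-1` A) `*` (g @^-1` B))).
rewrite product_measure1E; last 2 first.
- by rewrite -[X in measurable X]setTI; exact: mf.
- by rewrite -[X in measurable X]setTI; exact: mg.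
by congr (_ * _)%E; [exact: hf|exact: hg].
Qed.

(** Change of variables for a measure-preserving map. Treating positive and negative parts
    separately covers integrable and non-integrable [f] alike. *)
Lemma integral_preimage d (T : measurableType d) (R : realType)
    (mu : {measure set T -> \bar R}) (phi : T -> T) (D : set T) (f : T -> R) :
  measurable_fun setT phi ->
  (forall X, measurable X -> mu (phi @^-1` X) = mu X) ->
  measurable D -> measurable_fun setT f ->
  (\int[mu]_(x in D) (f x)%:E = \int[mu]_(x in phi @^-1` D) (f (phi x))%:E)%E.
Proof.
move=> mphi hphi mD mf.
have ge0 (g : T -> \bar R) : measurable_fun setT g -> (forall x, 0 <= g x)%E ->
  (\int[mu]_(x in D) g x = \int[mu]_(x in phi @^-1` D) g (phi x))%E.
  move=> mg g0; rewrite -[RHS](@ge0_integral_pushforward _ _ _ _ _ _ mphi mu D g)//.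
    by apply: eq_measure_integral => /= A mA _; exact/esym/hphi.
  exact: measurable_funTS.
have mEf : measurable_fun setT (fun x => (f x)%:E) by exact/measurable_EFinP.
rewrite integralE [RHS]integralE; congr (_ - _)%E.
- by rewrite ge0; [by apply: eq_integral => x _; rewrite !funeposE|exact: measurable_funepos|].
- by rewrite ge0; [by apply: eq_integral => x _; rewrite !funenegE|exact: measurable_funeneg|].
Qed.

Lemma lebesgue2_vline (R : realType) (a : R) :
  (lebesgue2 R) [set z | z.1 = a] = 0%E.
Proof.
have -> : [set z : R * R | z.1 = a] = [set a] `*` setT.
  by apply/seteqP; split => -[x y]//= [].
rewrite product_measure1E// [X in (X * _)%E](_ : _ = 0%E) ?mul0e//.
exact: lebesgue_measure_set1.
Qed.

Lemma lebesgue2_hline (R : realType) (a : R) :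
  (lebesgue2 R) [set z | z.2 = a] = 0%E.
Proof.
have -> : [set z : R * R | z.2 = a] = setT `*` [set a].
  by apply/seteqP; split => -[x y]//= [].
rewrite product_measure1E// [X in (_ * X)%E](_ : _ = 0%E) ?mule0//.
exact: lebesgue_measure_set1.
Qed.

Lemma integral_eq_mod_null d (T : measurableType d) (R : realType)
    (mu : {measure set T -> \bar R}) (D1 D2 N : set T) (f : T -> R) :
  measurable D1 -> measurable D2 -> measurable N -> mu N = 0%E ->
  D1 `\` N = D2 `\` N -> measurable_fun setT f ->
  (\int[mu]_(x in D1) (f x)%:E = \int[mu]_(x in D2) (f x)%:E)%E.
Proof.
move=> mD1 mD2 mN N0 DN mf.
have mEf : measurable_fun setT (fun x => (f x)%:E) by exact/measurable_EFinP.
rewrite integralE [RHS]integralE; congr (_ - _)%E.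
- have mf' : measurable_fun setT (fun x => (f x)%:E)^\+%E.
    exact: measurable_funepos.
  rewrite (ge0_negligible_integral mN)//; last exact: measurable_funTS.
  by rewrite DN -(ge0_negligible_integral mN)//; exact: measurable_funTS.
- have mf' : measurable_fun setT (fun x => (f x)%:E)^\-%E.
    exact: measurable_funeneg.
  rewrite (ge0_negligible_integral mN)//; last exact: measurable_funTS.
  by rewrite DN -(ge0_negligible_integral mN)//; exact: measurable_funTS.
Qed.

(** * Improper integrals of powers in one and two variables *)

Lemma derivable1_continuous_at (R : realType) (f : R -> R) (x : R) :
  derivable f x 1 -> {for x, continuous f}.
Proof. by move=> /derivable1_diffP; exact: differentiable_continuous. Qed.

(** Monotone convergence over growing segments, with the fundamental theorem of calculus on each. It
    serves both for a singularity at 0 and for an unbounded domain. *)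
Lemma integral_exhaustion_le (R : realType) (f F : R -> R) (a b : nat -> R) (C : R) :
  (forall n, a n < b n) -> nonincreasing_seq a -> nondecreasing_seq b ->
  (forall n x, a n <= x <= b n -> is_derive x 1 F (f x)) ->
  (forall n x, a n <= x <= b n -> {for x, continuous f}) ->
  (forall n x, a n <= x <= b n -> 0 <= f x) ->
  (forall n, F (b n) - F (a n) <= C) -> measurable_fun setT f ->
  (\int[@lebesgue_measure R]_(x in \bigcup_n `[a n, b n]%classic) (f x)%:E
     <= C%:E)%E.
Proof.
move=> ab na nb dF cf f0 FC mf.
pose I n : set (measurableTypeR R) := `[a n, b n]%classic.
have ndI : nondecreasing_seq I.
  apply/nondecreasing_seqP => n; rewrite subsetEset => x; rewrite /I/= !in_itv/=.
  have := na n n.+1 (leqnSn n); have := nb n n.+1 (leqnSn n); lra.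
have mI n : measurable (I n) by exact: measurable_itv.
have mfI n : measurable_fun (I n) (fun x => (f x)%:E).
  by apply/measurable_EFinP; exact: measurable_funTS.
have f0I n x : I n x -> (0 <= (f x)%:E)%E.
  by rewrite /I/= in_itv/= => /f0; rewrite lee_fin.
have /cvg_lim <-// :=
  ge0_nondecreasing_set_cvg_integral (mu := @lebesgue_measure R) ndI mI mfI f0I.
apply: lime_le.
  apply: ereal_nondecreasing_is_cvgn; apply/nondecreasing_seqP => n.
  apply: ge0_subset_integral => //; first exact: f0I.
  by rewrite -subsetEset; exact: ndI.
apply: nearW => n.
rewrite (@continuous_FTC2 _ f F)//.
- by rewrite -EFinB lee_fin.
- by apply: continuous_in_subspaceT => x; rewrite inE/= in_itv/=; exact: cf.
- have dcF x : a n <= x <= b n -> derivable F x 1 by move=> /dF[].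
  have ccF x : a n <= x <= b n -> {for x, continuous F}.
    by move=> /dcF; exact: derivable1_continuous_at.
  split.
  + by move=> x; rewrite in_itv/= => /andP[/ltW ? /ltW ?]; apply: dcF; lra.
  + by apply: cvg_at_right_filter; apply: ccF; rewrite lexx ltW.
  + by apply: cvg_at_left_filter; apply: ccF; rewrite lexx ltW.
- move=> x; rewrite in_itv/= => /andP[/ltW ? /ltW ?].
  have /dF h : a n <= x <= b n by lra.
  by rewrite derive1E; exact: derive_val.
Qed.

Lemma powR_continuous (R : realType) (s x : R) : 0 < x -> {for x, continuous (@powR R ^~ s)}.
Proof.
move=> x0; apply: derivable1_continuous_at.
by have [] := is_derive1_powR s x0.
Qed.

Lemma integral_powR_near0 (R : realType) (s h : R) : 0 < s < 1 -> 0 < h ->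
  (\int[@lebesgue_measure R]_(x in `]0%R, h]) (x `^ (- s))%:E
     <= (h `^ (1 - s) / (1 - s))%:E)%E.
Proof.
move=> /andP[s0 s1] h0; have s10 : 0 < 1 - s by lra.
(* The shift to [n + 2] makes the first segment nondegenerate, as the exhaustion lemma requires. *)
have -> : `]0, h]%classic = \bigcup_n `[h / n.+2%:R, h]%classic.
  apply/seteqP; split => x/=.
    rewrite in_itv/= => /andP[x0 xh].
    exists (Num.truncn (h / x)) => //=; rewrite in_itv/= xh andbT.
    rewrite ler_pdivrMr// mulrC -ler_pdivrMr//.
    apply: ltW; apply: lt_trans (truncnS_gt _) _; by rewrite ltr_nat.
  move=> [n _]/=; rewrite !in_itv/= => /andP[x0 ->]; rewrite andbT.
  by apply: lt_le_trans x0; rewrite divr_gt0.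
have pos n x : h / n.+2%:R <= x -> 0 < x.
  by apply: lt_le_trans; rewrite divr_gt0.
apply: (@integral_exhaustion_le _ _ (fun x => x `^ (1 - s) / (1 - s))).
- by move=> n; rewrite ltr_pdivrMr// ltr_pMr// ltr1n.
- move=> m n mn; rewrite ler_pM2l// lef_pV2 ?posrE// ler_nat.
  by rewrite !ltnS.
- by [].
- move=> n x /andP[/pos x0 _].
  have := is_derive1_powR (1 - s) x0 => h1.
  have -> : (fun x0 : R => x0 `^ (1 - s) / (1 - s)) = (1 - s)^-1 \*: (@powR R ^~ (1 - s)).
    by apply/funext => y/=; rewrite mulrC.
  apply: is_derive_eq; rewrite /GRing.scale/= mulKf ?gt_eqF//; congr powR; lra.
- by move=> n x /andP[/pos x0 _]; exact: powR_continuous.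
- by move=> n x _; exact: powR_ge0.
- by move=> n; rewrite gerBl divr_ge0// ?powR_ge0// ltW.
- exact: measurable_powR.
Qed.

Lemma integral_powR_nearoo (R : realType) (s : R) : 0 < s ->
  (\int[@lebesgue_measure R]_(x in `[0%R, +oo[) ((1 + x) `^ (- 1 - s))%:E
     <= (s^-1)%:E)%E.
Proof.
move=> s0.
have -> : `[0%R, +oo[%classic = \bigcup_n `[0 : R, n.+1%:R]%classic.
  apply/seteqP; split => x/=; rewrite in_itv/= ?andbT => x0.
    exists (Num.truncn x) => //=; rewrite in_itv/= x0/=.
    by apply: ltW; exact: truncnS_gt.
  by case: x0 => n _/=; rewrite in_itv/= => /andP[].
apply: (@integral_exhaustion_le _ _ (fun x => - (1 + x) `^ (- s) / s)).
- by [].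
- by [].
- by move=> m n mn; rewrite ler_nat.
- move=> n x /andP[x0 _].
  have x10 : 0 < 1 + x by lra.
  have := is_derive1_powR (- s) x10 => h1.
  have -> : (fun x0 : R => - (1 + x0) `^ (- s) / s) = (- s^-1) \*: ((@powR R ^~ (- s)) \o (cst 1 + id)).
    by apply/funext => y/=; rewrite mulrC mulrN -mulNr.
  apply: is_derive_eq; rewrite add0r.
  rewrite /GRing.scale/= mulr1 mulrA mulrNN mulVf ?gt_eqF// mul1r; congr powR; lra.
- move=> n x /andP[x0 _].
  have : {for x, continuous ((@powR R ^~ (-1 - s)) \o (+%R 1))}.
    apply: continuous_comp.
      by apply: continuousD; [exact: cst_continuous|exact: cvg_id].
    by apply: powR_continuous; lra.
  exact.
- by move=> n x _; exact: powR_ge0.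
- move=> n; rewrite addr0 powR1 /= !mulNr mul1r opprK.
  suff : 0 <= (1 + n.+1%:R) `^ (- s) / s by lra.
  by rewrite divr_ge0 ?powR_ge0// ltW.
- have : measurable_fun [set: R] ((@powR R ^~ (-1 - s)) \o (+%R 1)).
    apply: measurableT_comp; [exact: measurable_powR|exact: measurable_funD].
  exact.
Qed.

Lemma powR_le_npos (R : realType) (a b r : R) : 0 < a -> a <= b -> r <= 0 ->
  b `^ r <= a `^ r.
Proof.
move=> a0 ab r0; have b0 : 0 < b by apply: lt_le_trans ab.
rewrite -[r]opprK [leLHS]powRN [leRHS]powRN lef_pV2 ?posrE ?powR_gt0//.
by rewrite ge0_ler_powR ?oppr_ge0 ?nnegrE ?(ltW a0) ?(ltW b0).
Qed.

(** Tonelli: the indicator of [A * B] is distributed over the two factors, after which both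
    integrals run over whole spaces. *)
Lemma integral_prod_fun (R : realType) (f g : R -> R) (A B : set R) :
  measurable A -> measurable B ->
  measurable_fun setT f -> measurable_fun setT g ->
  (forall x, 0 <= f x) -> (forall x, 0 <= g x) ->
  (\int[lebesgue2 R]_(z in A `*` B) (f z.1 * g z.2)%:E =
   \int[@lebesgue_measure R]_(x in A) (f x)%:E *
   \int[@lebesgue_measure R]_(x in B) (g x)%:E)%E.
Proof.
move=> mA mB mf mg f0 g0.
rewrite integral_mkcond [X in (_ = X * _)%E]integral_mkcond.
rewrite [X in (_ = _ * X)%E]integral_mkcond.
set fA := (_ \_ A); set gB := (_ \_ B).
have mfA : measurable_fun [set: measurableTypeR R] fA.
  apply/(measurable_restrictT _ mA).
  by apply: measurable_funTS; apply/measurable_EFinP.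
have mgB : measurable_fun [set: measurableTypeR R] gB.
  apply/(measurable_restrictT _ mB).
  by apply: measurable_funTS; apply/measurable_EFinP.
have fA0 x : (0 <= fA x)%E by apply: erestrict_ge0 => y _; rewrite lee_fin.
have gB0 x : (0 <= gB x)%E by apply: erestrict_ge0 => y _; rewrite lee_fin.
under eq_integral => z _.
  have -> : ((fun z => (f z.1 * g z.2)%:E) \_ (A `*` B)) z = (fA z.1 * gB z.2)%E.
    rewrite /fA /gB !patchE in_setX.
    by case: (z.1 \in A); case: (z.2 \in B) => //=; rewrite ?mul0e ?mule0.
  over.
rewrite fubini_tonelli1; last 2 first.
- by apply: emeasurable_funM; apply: measurableT_comp.
- by move=> z; rewrite mule_ge0.
rewrite /fubini_F/=.
under eq_integral do rewrite ge0_integralZl//.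
rewrite ge0_integralZr//.
exact: integral_ge0.
Qed.

Lemma measurable_fun_powR d (T : measurableType d) (R : realType)
    (f : T -> R) (s : R) :
  measurable_fun setT f -> measurable_fun setT (fun x => f x `^ s).
Proof.
move=> mf; have : measurable_fun setT ((@powR R ^~ s) \o f).
  by apply: measurableT_comp => //; exact: measurable_powR.
exact.
Qed.

Lemma measurable_fun_expR d (T : measurableType d) (R : realType) (f : T -> R) :
  measurable_fun setT f -> measurable_fun setT (fun x => expR (f x)).
Proof. by move=> mf; apply: measurableT_comp => //; exact: measurable_expR. Qed.

(** * Integrals of powers of the Euclidean norm *)

Section euclidean_norm.
Context {R : realType}.
Implicit Types z : R * R.

Lemma enorm_ge0 z : 0 <= enorm z. Proof. exact: sqrtr_ge0. Qed.

Lemma sqr_enorm z : enorm z ^+ 2 = z.1 ^+ 2 + z.2 ^+ 2.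
Proof. by rewrite sqr_sqrtr// addr_ge0// sqr_ge0. Qed.

Lemma enorm_fst z : `|z.1| <= enorm z.
Proof. by rewrite -sqrtr_sqr ler_wsqrtr// lerDl sqr_ge0. Qed.

Lemma enorm_snd z : `|z.2| <= enorm z.
Proof. by rewrite -sqrtr_sqr ler_wsqrtr// lerDr sqr_ge0. Qed.

Lemma measurable_enorm : measurable_fun setT (@enorm R).
Proof.
have : measurable_fun [set: R * R] (Num.sqrt \o (fun z : R * R => z.1 ^+ 2 + z.2 ^+ 2)).
  apply: measurableT_comp; first by apply: continuous_measurable_fun; exact: sqrt_continuous.
  by apply: measurable_funD; apply: measurable_funX.
exact.
Qed.

Lemma enorm_powR z s : enorm z `^ s = (z.1 ^+ 2 + z.2 ^+ 2) `^ (s / 2).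
Proof.
by rewrite /enorm -powR12_sqrt ?addr_ge0 ?sqr_ge0// -powRrM mulrC.
Qed.

(* [|z|^2 >= z.1 * z.2] separates the variables and replaces polar
   coordinates. *)
Lemma integral_enorm_near0 (b h : R) : 0 < b < 2 -> 0 < h ->
  (\int[lebesgue2 R]_(z in `]0%R, h] `*` `]0%R, h]) (enorm z `^ (- b))%:E
    <= ((1 - b / 2) ^- 2 * h `^ (2 - b))%:E)%E.
Proof.
move=> b02 h0.
have hs : 0 < b / 2 < 1 by lra.
apply: (@le_trans _ _ (\int[lebesgue2 R]_(z in `]0%R, h] `*` `]0%R, h])
    (z.1 `^ (- (b / 2)) * z.2 `^ (- (b / 2)))%:E)%E).
  apply: ge0_le_integral.
  - by apply: measurableX; exact: measurable_itv.
  - by move=> z _; rewrite lee_fin powR_ge0.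
  - apply: measurable_funTS; apply/measurable_EFinP.
    by apply: measurable_fun_powR; exact: measurable_enorm.
  - apply: measurable_funTS; apply/measurable_EFinP.
    by apply: measurable_funM; apply: measurable_fun_powR.
  - move=> [x y] /=; rewrite !in_itv/= => -[/andP[x0 _] /andP[y0 _]].
    rewrite lee_fin -powRM ?(ltW x0) ?(ltW y0)// enorm_powR/= -mulNr.
    apply: powR_le_npos; [by rewrite mulr_gt0| |lra].
    suff : 0 <= (x - y) ^+ 2 + x * y by rewrite sqrrB; lra.
    by rewrite addr_ge0 ?sqr_ge0// mulr_ge0 ?ltW.
rewrite (@integral_prod_fun R (fun x => x `^ (- (b / 2))) (fun x => x `^ (- (b / 2))))//;
  try exact: measurable_itv; try exact: measurable_powR;
  try by move=> x; exact: powR_ge0.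
have := integral_powR_near0 hs h0.
set I := (\int[_]_(_ in _) _)%E => hI.
have I0 : (0 <= I)%E by apply: integral_ge0 => x _; rewrite lee_fin powR_ge0.
apply: le_trans (lee_pmul I0 I0 hI hI) _.
rewrite -EFinM lee_fin le_eqVlt; apply/orP; left; apply/eqP.
have -> : 2 - b = (1 - b / 2) + (1 - b / 2) by lra.
rewrite [in RHS]powRD; last by rewrite (gt_eqF h0) implybT.
have s1 : 1 - b / 2 != 0 by lra.
by rewrite mulf_div -expr2 mulrC.
Qed.

(* For [|z| > e], the bound [(1 + |z.1|) (1 + |z.2|) <= ((1 + e^-1) |z|)^2]
   separates the variables. *)
Lemma integrable_enorm_far (b e : R) : 0 < b -> 0 < e ->
  (lebesgue2 R).-integrable [set z | e < enorm z]
    (EFin \o (fun z => enorm z `^ (- (2 + b)))).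
Proof.
move=> b0 e0; pose s := b / 2; have s0 : 0 < s by rewrite divr_gt0.
pose RR := (measurableTypeR R * measurableTypeR R)%type.
have mE : measurable ([set z : R * R | e < enorm z] : set RR).
  have -> : [set z : R * R | e < enorm z] = enorm @^-1` `]e, +oo[%classic.
    by apply/seteqP; split => z/=; rewrite in_itv/= andbT.
  rewrite -[X in measurable X]setTI; apply: measurable_enorm => //.
have mf : measurable_fun [set: RR] (fun z : R * R => enorm z `^ (- (2 + b))).
  by apply: measurable_fun_powR; exact: measurable_enorm.
(* Each coordinate receives half of the exponent [- (2 + b)], and [s > 0] makes each half integrable
   at infinity. *)
pose F (x : R) := (1 + `|x|) `^ (- 1 - s).
have mF : measurable_fun setT F.
  apply: measurable_fun_powR.
  by apply: measurable_funD => //; exact: normr_measurable.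
have F0 x : 0 <= F x by exact: powR_ge0.
pose c := (1 + e^-1) `^ (2 + b).
have mFF : measurable_fun setT (fun z : R * R => F z.1 * F z.2).
  by apply: measurable_funM; apply: measurableT_comp.
have intFF : (lebesgue2 R).-integrable setT (EFin \o (fun z => F z.1 * F z.2)).
  apply/integrableP; split; first exact/measurable_EFinP.
  under eq_integral => z _ do rewrite /= ger0_norm ?mulr_ge0//.
  rewrite -setXTT integral_prod_fun//.
  suff h : (\int[@lebesgue_measure R]_x (F x)%:E < +oo)%E.
    apply: lte_mul_pinfty => //.
    + by apply: integral_ge0 => x _; rewrite lee_fin.
    + by rewrite ge0_fin_numE//; apply: integral_ge0 => x _; rewrite lee_fin.
  rewrite ge0_symfun_integralT//; last 2 first.
  - move=> x.
    have : {for x, continuous ((@powR R ^~ (- 1 - s)) \o (fun x : R => 1 + `|x|))}.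
      apply: continuous_comp.
        by apply: continuousD; [exact: cst_continuous|exact: norm_continuous].
      by apply: powR_continuous; rewrite ltr_pwDl.
    exact.
  - by move=> x; rewrite /F/= normrN.
  apply: lte_mul_pinfty => //.
  apply: le_lt_trans (ltry (s^-1)).
  apply: le_trans (integral_powR_nearoo s0).
  rewrite le_eqVlt; apply/orP; left; apply/eqP.
  rewrite set_itvcy; apply: eq_integral => x; rewrite inE/= => x0.
  by rewrite /F ger0_norm.
have intE := integrableZl mE c (integrableS measurableT mE (@subsetT _ _) intFF).
apply: (le_integrable mE _ _ intE).
- by apply/measurable_EFinP; exact: measurable_funTS.
- move=> z/= ez; rewrite lee_fin ger0_norm ?powR_ge0//.
  rewrite ger0_norm; last by rewrite mulr_ge0 ?mulr_ge0 ?powR_ge0.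
  have r0 : 0 < enorm z by apply: lt_trans ez.
  rewrite /F -powRM ?addr_ge0//.
  have -> : - 1 - s = - ((2 + b) / 2) by rewrite /s; lra.
  pose k := (1 + e^-1) * enorm z.
  have k0 : 0 < k by rewrite mulr_gt0// addr_gt0// invr_gt0.
  have kE : enorm z `^ (- (2 + b)) = c * (k ^+ 2) `^ (- ((2 + b) / 2)).
    rewrite -[k ^+ 2]powR_mulrn ?ltW// -powRrM.
    have -> : 2%:R * (- ((2 + b) / 2)) = - (2 + b) by lra.
    rewrite /k powRM ?(ltW r0)//; last by rewrite addr_ge0// invr_ge0 ltW.
    rewrite mulrA /c -powRD ?addrN ?powRr0 ?mul1r// eqxx/=.
    by rewrite gt_eqF// addr_gt0// invr_gt0.
  rewrite kE ler_wpM2l ?powR_ge0//; apply: powR_le_npos; [|  |lra].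
    by rewrite mulr_gt0// ltr_pwDl.
  have one : 1 <= e^-1 * enorm z by rewrite mulrC ler_pdivlMr// mul1r ltW.
  rewrite expr2; apply: ler_pM; rewrite ?addr_ge0// /k mulrDl mul1r.
  - by have := enorm_fst z; lra.
  - by have := enorm_snd z; lra.
Qed.

End euclidean_norm.
(** * Second derivatives of the difference quotient *)

Section derivative_of_expressions.
Context {R : realType}.
Implicit Types (f g : R -> R) (x a b : R).

Lemma is_derive_mul f g x a b : is_derive x 1 f a -> is_derive x 1 g b ->
  is_derive x 1 (fun t => f t * g t) (a * g x + f x * b).
Proof.
move=> df dg; apply: (is_derive_eq (is_deriveM df dg)).
by rewrite /GRing.scale/= addrC [g x * a]mulrC.
Qed.

Lemma is_derive_add f g x a b : is_derive x 1 f a -> is_derive x 1 g b ->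
  is_derive x 1 (fun t => f t + g t) (a + b).
Proof. by move=> df dg; exact: (is_deriveD df dg). Qed.

Lemma is_derive_opp f x a : is_derive x 1 f a ->
  is_derive x 1 (fun t => - f t) (- a).
Proof. by move=> df; exact: (is_deriveN df). Qed.

Lemma is_derive_chain f g x a b : is_derive (g x) 1 f a -> is_derive x 1 g b ->
  is_derive x 1 (fun t => f (g t)) (a * b).
Proof. by move=> df dg; apply: (is_derive_eq (is_derive1_comp df dg)). Qed.

Lemma is_derive_shiftD f x y a : is_derive (y + x) 1 f a ->
  is_derive x 1 (fun t => f (y + t)) a.
Proof.
move=> df.
suff : is_derive x 1 (fun t => f (y + t)) (a * (0 + 1)) by rewrite add0r mulr1.
exact: is_derive_chain df _.
Qed.

Lemma is_derive_shiftB f x y a : is_derive (y - x) 1 f a ->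
  is_derive x 1 (fun t => f (y - t)) (- a).
Proof.
move=> df.
suff : is_derive x 1 (fun t => f (y - t)) (a * (0 + - 1)) by rewrite add0r mulrN1.
have dg : is_derive x 1 (fun t : R => y - t) (0 + - 1).
  exact: is_derive_add.
exact (@is_derive_chain f (fun t => y - t) x a (0 + - 1) df dg).
Qed.

End derivative_of_expressions.

Section radial_weight.
Context {R : realType}.
Variables (lam gam eta : R).

Let r (t : R) := Num.sqrt (t ^+ 2 + eta ^+ 2).
(** [- (t * m t)] is the logarithmic derivative of [radial_weight], because [r' = t / r]. The middle
    term of [radial_weight''] is [- t * m']. *)
Let m (t : R) := lam * (r t)^-1 + gam * (r t)^-1 ^+ 2.

(* The factor [exp (- lam |z|) |z|^(- gam)] of [fd_phi] along a line at distance
   [eta] from a coordinate axis; primes denote its derivatives in [t]. *)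
Definition radial_weight (t : R) := expR (- (lam * r t)) * r t `^ (- gam).

Definition radial_weight' (t : R) := - (t * m t) * radial_weight t.

Definition radial_weight'' (t : R) :=
  (- m t + t ^+ 2 * (lam * (r t)^-1 ^+ 3 + 2 * gam * (r t)^-1 ^+ 4)
   + t ^+ 2 * m t ^+ 2) * radial_weight t.

Let is_derive_r t : 0 < t ^+ 2 + eta ^+ 2 -> is_derive t 1 r (t * (r t)^-1).
Proof.
move=> s0.
have r0 : r t != 0 by rewrite gt_eqF// sqrtr_gt0.
have ds : is_derive t 1 (fun t => t * t + eta ^+ 2) (1 * t + t * 1 + 0).
  exact: (is_derive_add (is_derive_mul (is_derive_id t 1) (is_derive_id t 1))
                        (is_derive_cst (eta ^+ 2) t 1)).
have dq := is_derive1_sqrt s0.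
have dr : is_derive t 1 r ((2 * r t)^-1 * (1 * t + t * 1 + 0)).
  exact (@is_derive_chain R Num.sqrt (fun t => t * t + eta ^+ 2) t _ _ dq ds).
by apply: (is_derive_eq dr); field.
Qed.

Let is_derive_rV t : 0 < t ^+ 2 + eta ^+ 2 ->
  is_derive t 1 (fun t => (r t)^-1) (- t * (r t)^-1 ^+ 3).
Proof.
move=> s0.
have r0 : r t != 0 by rewrite gt_eqF// sqrtr_gt0.
apply: (is_derive_eq (@is_deriveV _ _ _ _ _ r0 (is_derive_r s0))).
by rewrite /GRing.scale/=; field.
Qed.

Lemma is_derive_radial_weight t : 0 < t ^+ 2 + eta ^+ 2 ->
  is_derive t 1 radial_weight (radial_weight' t).
Proof.
move=> s0; have r0 : 0 < r t by rewrite sqrtr_gt0.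
have dr := is_derive_r s0.
have dl : is_derive t 1 (fun t => - (lam * r t)) (- (0 * r t + lam * (t * (r t)^-1))).
  exact: (is_derive_opp (is_derive_mul (is_derive_cst lam t 1) dr)).
have de := is_derive_chain (is_derive_expR _) dl.
have dp := is_derive_chain (is_derive1_powR (- gam) r0) dr.
apply: (is_derive_eq (is_derive_mul de dp)).
rewrite /radial_weight' /radial_weight.
have -> : r t `^ (- gam - 1) = r t `^ (- gam) * (r t)^-1.
  by rewrite powRD ?(gt_eqF r0) ?implybT// powR_inv1// ltW.
rewrite /m; field.
by rewrite gt_eqF.
Qed.

Lemma is_derive_radial_weight' t : 0 < t ^+ 2 + eta ^+ 2 ->
  is_derive t 1 radial_weight' (radial_weight'' t).
Proof.
move=> s0; have r0 : 0 < r t by rewrite sqrtr_gt0.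
have dV := is_derive_rV s0.
have dm : is_derive t 1 m (0 * (r t)^-1 + lam * (- t * (r t)^-1 ^+ 3) +
   (0 * ((r t)^-1 * (r t)^-1) + gam * ((- t * (r t)^-1 ^+ 3) * (r t)^-1
    + (r t)^-1 * (- t * (r t)^-1 ^+ 3)))).
  exact: (is_derive_add (is_derive_mul (is_derive_cst lam t 1) dV)
    (is_derive_mul (is_derive_cst gam t 1) (is_derive_mul dV dV))).
have dtm := is_derive_opp (is_derive_mul (is_derive_id t 1) dm).
apply: (is_derive_eq (is_derive_mul dtm (is_derive_radial_weight s0))).
rewrite /radial_weight'' /radial_weight' /m.
by move: (radial_weight t) => w; ring.
Qed.

End radial_weight.
Section radial_weight_bounds.
Context {R : realType}.
Variables (lam gam eta t R0 : R).
Hypotheses (lam0 : 0 <= lam) (gam0 : 0 <= gam).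
Let r := Num.sqrt (t ^+ 2 + eta ^+ 2).
Hypotheses (r_gt0 : 0 < r) (r_le : r <= R0).
Let L := lam * R0 + gam.

(** This is [r ^+ 2 * m]; with the ratio [th = t / r], at most 1 in absolute value, it rewrites the
    derivatives of the weight in scale-free form. *)
Let q := lam * r + gam.
Let q_ge0 : 0 <= q. Proof. by rewrite addr_ge0 ?mulr_ge0// ltW. Qed.
Let q_le : q <= L. Proof. by rewrite lerD2r ler_wpM2l. Qed.

Let th := t * r^-1.
Let th2_le1 : th ^+ 2 <= 1.
Proof.
rewrite exprMn exprVn ler_pdivrMr ?exprn_gt0// mul1r sqr_sqrtr ?lerDl ?sqr_ge0//.
by rewrite addr_ge0 ?sqr_ge0.
Qed.

Lemma radial_weight_ge0 : 0 <= radial_weight lam gam eta t.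
Proof. by rewrite mulr_ge0 ?expR_ge0 ?powR_ge0. Qed.

Lemma radial_weight_le : radial_weight lam gam eta t <= r `^ (- gam).
Proof.
rewrite /radial_weight -/r ler_piMl ?powR_ge0// -expR0 ler_expR oppr_le0.
by rewrite mulr_ge0// ltW.
Qed.

(** One derivative costs one factor [1 / r]: the weight is multiplied by [- th * q / r], and
    [q <= L]. *)
Lemma radial_weight'_le : r * `|radial_weight' lam gam eta t| <= L * r `^ (- gam).
Proof.
have -> : radial_weight' lam gam eta t = - (th * q * r^-1) * radial_weight lam gam eta t.
  by rewrite /radial_weight' /th /q -/r; field; rewrite gt_eqF.
rewrite normrM (ger0_norm radial_weight_ge0) mulrA.
apply: ler_pM => //; [by rewrite mulr_ge0// ltW|exact: radial_weight_ge0| |exact: radial_weight_le].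
have -> : r * `|- (th * q / r)| = `|th| * q.
  rewrite normrN !normrM normfV (gtr0_norm r_gt0) (ger0_norm q_ge0).
  by field; rewrite gt_eqF.
rewrite -[leRHS]mul1r; apply: ler_pM => //.
by rewrite -(@expr_le1 _ 2)// -normrX ger0_norm// sqr_ge0.
Qed.

(** After multiplication by [r ^+ 2] the factor in front of the weight is a sum of three terms,
    bounded by [L], [2 * L] and [L ^+ 2] in turn. *)
Lemma radial_weight''_le :
  r ^+ 2 * `|radial_weight'' lam gam eta t| <= (3 * L + L ^+ 2) * r `^ (- gam).
Proof.
have -> : radial_weight'' lam gam eta t =
   ((- q + th ^+ 2 * (lam * r + 2 * gam) + th ^+ 2 * q ^+ 2) * r ^- 2)
     * radial_weight lam gam eta t.
  by rewrite /radial_weight'' /th /q -/r; field; rewrite gt_eqF.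
rewrite normrM (ger0_norm radial_weight_ge0) mulrA.
apply: ler_pM => //; [by rewrite mulr_ge0 ?sqr_ge0|exact: radial_weight_ge0| |exact: radial_weight_le].
rewrite normrM [X in _ * (_ * X)]ger0_norm ?invr_ge0 ?sqr_ge0//.
rewrite mulrC mulfVK ?sqrf_eq0 ?gt_eqF//.
have L0 : 0 <= L by apply: le_trans q_le.
have th0 : 0 <= th ^+ 2 by rewrite sqr_ge0.
have h1 : `|th ^+ 2 * (lam * r + 2 * gam)| <= 2 * L.
  rewrite ger0_norm; last by rewrite mulr_ge0// addr_ge0 ?mulr_ge0// ltW.
  rewrite -[leRHS]mul1r; apply: ler_pM => //; first by rewrite addr_ge0 ?mulr_ge0// ltW.
  by have := mulr_ge0 lam0 (ltW r_gt0); move: q_le; rewrite /q; lra.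
have h2 : `|th ^+ 2 * q ^+ 2| <= L ^+ 2.
  rewrite ger0_norm; last by rewrite mulr_ge0// sqr_ge0.
  rewrite -[leRHS]mul1r; apply: ler_pM => //; first by rewrite sqr_ge0.
  by rewrite lerXn2r ?nnegrE.
apply: le_trans (ler_normD _ _) _; apply: le_trans (lerD (ler_normD _ _) h2) _.
rewrite lerD2r normrN (ger0_norm q_ge0); move: q_le; lra.
Qed.

End radial_weight_bounds.

(** * Interpolation error along a line parallel to an axis *)

Lemma symmetric_shift_range (R : realType) (x a b t : R) : 0 <= a ->
  a <= t <= b -> x - b <= x + t <= x + b /\ x - b <= x - t <= x + b.
Proof. by move=> a0 tab; split; lra. Qed.

(* Along a line parallel to an axis, [fd_g u p] has the shape of [G] below: in the
   first coordinate, [v1] and [v2] are [u] at heights [p.2 + eta] and [p.2 - eta]. *)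
Section even_extension_interp.
Context {R : realType}.
Variables (v1 v1' v1'' v2 v2' v2'' : R -> R) (x k lam gam eta a b M B R0 rho : R).
Hypotheses (lam0 : 0 <= lam) (gam0 : 0 <= gam) (a0 : 0 <= a) (ab : a < b).
Hypothesis rho0 : 0 < rho.
Hypotheses
  (dv1 : forall y, x - b <= y <= x + b -> is_derive y 1 v1 (v1' y))
  (dv1' : forall y, x - b <= y <= x + b -> is_derive y 1 v1' (v1'' y))
  (dv2 : forall y, x - b <= y <= x + b -> is_derive y 1 v2 (v2' y))
  (dv2' : forall y, x - b <= y <= x + b -> is_derive y 1 v2' (v2'' y))
  (v1M : forall y, x - b <= y <= x + b -> `|v1'' y| <= M)
  (v2M : forall y, x - b <= y <= x + b -> `|v2'' y| <= M).
Let r t := Num.sqrt (t ^+ 2 + eta ^+ 2).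
Hypothesis r_range : forall t, a <= t <= b -> rho <= r t <= R0.
Let G t := v1 (x + t) + v1 (x - t) + (v2 (x + t) + v2 (x - t)) + k.
Hypothesis G_le : forall t, a <= t <= b -> `|G t| <= B * r t ^+ 2.
Let L := lam * R0 + gam.

Let G' t := v1' (x + t) - v1' (x - t) + (v2' (x + t) - v2' (x - t)).
Let G'' t := v1'' (x + t) + v1'' (x - t) + (v2'' (x + t) + v2'' (x - t)).

Let shift_range t : a <= t <= b ->
  x - b <= x + t <= x + b /\ x - b <= x - t <= x + b.
Proof. exact: symmetric_shift_range. Qed.

Let dG t : a <= t <= b -> is_derive t 1 G (G' t).
Proof.
move=> tab.
have [hp hm] := shift_range tab.
have h1 := @is_derive_shiftD _ v1 t x _ (dv1 hp).
have h2 := @is_derive_shiftB _ v1 t x _ (dv1 hm).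
have h3 := @is_derive_shiftD _ v2 t x _ (dv2 hp).
have h4 := @is_derive_shiftB _ v2 t x _ (dv2 hm).
have := is_derive_add (is_derive_add (is_derive_add h1 h2)
  (is_derive_add h3 h4)) (is_derive_cst k t 1).
by rewrite addr0.
Qed.

Let dG' t : a <= t <= b -> is_derive t 1 G' (G'' t).
Proof.
move=> tab; rewrite /G'' -[v1'' (x - t)]opprK -[v2'' (x - t)]opprK.
have [hp hm] := shift_range tab.
have h1 := @is_derive_shiftD _ v1' t x _ (dv1' hp).
have h2 := @is_derive_shiftB _ v1' t x _ (dv1' hm).
have h3 := @is_derive_shiftD _ v2' t x _ (dv2' hp).
have h4 := @is_derive_shiftB _ v2' t x _ (dv2' hm).
have := is_derive_add (is_derive_add h1 (is_derive_opp h2))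
  (is_derive_add h3 (is_derive_opp h4)).
exact.
Qed.

Let M0 : 0 <= M.
Proof. by apply: le_trans (v1M (_ : x - b <= x <= x + b)) => //; move: a0 ab; lra. Qed.

(** This is applied with [v1'] and [v2'] in the place of [v]: [G'] is made of differences at
    symmetric points, so it is [O(t)] and makes up for the factor [1 / r] in the derivative of the
    weight. *)
Let symdiff_le (v v' : R -> R) t : a <= t <= b ->
  (forall y, x - b <= y <= x + b -> is_derive y 1 v (v' y)) ->
  (forall y, x - b <= y <= x + b -> `|v' y| <= M) ->
  `|v (x + t) - v (x - t)| <= 2 * M * t.
Proof.
move=> tab dv vM.
have t0 : 0 <= t by apply: le_trans a0 _; case/andP: tab.
have [||c cI ->] := @MVT_closed _ v v' (x - t) (x + t); first lra.
  by move=> y yI; apply: dv; lra.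
rewrite normrM.
have -> : `|x + t - (x - t)| = 2 * t by rewrite ger0_norm; lra.
have : `|v' c| * (2 * t) <= M * (2 * t) by apply: ler_wpM2r; [lra|apply: vM; lra].
lra.
Qed.

Let G'_le t : a <= t <= b -> `|G' t| <= 4 * M * r t.
Proof.
move=> tab; apply: le_trans (ler_normD _ _) _.
have h1 := symdiff_le tab dv1' v1M; have h2 := symdiff_le tab dv2' v2M.
have tr : t <= r t.
  apply: le_trans (ler_norm _) _.
  by rewrite -sqrtr_sqr ler_wsqrtr// lerDl sqr_ge0.
have : M * t <= M * r t by rewrite ler_wpM2l.
lra.
Qed.

Let G''_le t : a <= t <= b -> `|G'' t| <= 4 * M.
Proof.
move=> tab; apply: le_trans (ler_normD _ _) _.
apply: le_trans (lerD (ler_normD _ _) (ler_normD _ _)) _.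
have [hp hm] := shift_range tab.
have h1 : `|v1'' (x + t)| <= M by exact: v1M.
have h2 : `|v1'' (x - t)| <= M by exact: v1M.
have h3 : `|v2'' (x + t)| <= M by exact: v2M.
have h4 : `|v2'' (x - t)| <= M by exact: v2M.
lra.
Qed.

Let phi t := G t * radial_weight lam gam eta t.

(** Leibniz: in [G'' * w + 2 * G' * w' + G * w''] the powers of [r] gained by [G] cancel those lost
    by the weight, and the three parts of the constant are the three resulting bounds. Then [r] is
    replaced by its lower bound [rho], the exponent being nonpositive. *)
Lemma even_extension_interp_error t : a <= t <= b ->
  `|phi t - (phi a * (b - t) + phi b * (t - a)) / (b - a)| <=
  (4 * M + 8 * M * L + B * (3 * L + L ^+ 2)) * rho `^ (- gam) * (b - a) ^+ 2.
Proof.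
pose w := radial_weight lam gam eta; pose w' := radial_weight' lam gam eta.
pose w'' := radial_weight'' lam gam eta.
have s0 y : a <= y <= b -> 0 < y ^+ 2 + eta ^+ 2.
  by move=> /r_range /andP[h _]; rewrite -sqrtr_gt0; exact: lt_le_trans h.
apply: (@linear_interp_error _ phi (fun t => G' t * w t + G t * w' t)
  (fun t => G'' t * w t + G' t * w' t + (G' t * w' t + G t * w'' t))) => //.
- move=> y yab; apply: is_derive_mul; first exact: dG.
  by apply: is_derive_radial_weight; exact: s0.
- move=> y yab; have y0 := s0 _ yab; apply: is_derive_add; apply: is_derive_mul.
  + exact: dG'.
  + exact: is_derive_radial_weight.
  + exact: dG.
  + exact: is_derive_radial_weight'.
- move=> y yab; have /andP[ry1 ry2] := r_range yab.
  have r0 : 0 < r y by apply: lt_le_trans ry1.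
  have B0 : 0 <= B.
    have := le_trans (normr_ge0 _) (G_le yab).
    by rewrite pmulr_lge0// exprn_gt0.
  have L0 : 0 <= L by rewrite addr_ge0// mulr_ge0// ltW// (lt_le_trans r0).
  have C0 : 0 <= 4 * M + 8 * M * L + B * (3 * L + L ^+ 2).
    have := mulr_ge0 M0 L0; have := mulr_ge0 B0 L0.
    by have := mulr_ge0 B0 (sqr_ge0 L); have := M0; lra.
  apply: (@le_trans _ _ ((4 * M + 8 * M * L + B * (3 * L + L ^+ 2)) * r y `^ (- gam))); last first.
    by rewrite ler_wpM2l// powR_le_npos// oppr_le0.
  have h0 : `|G'' y * w y| <= 4 * M * r y `^ (- gam).
    rewrite normrM ler_pM// ?G''_le// ger0_norm ?radial_weight_ge0//.
    exact: radial_weight_le.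
  have h1 : `|G' y * w' y| <= 4 * M * (L * r y `^ (- gam)).
    rewrite normrM; apply: (@le_trans _ _ (4 * M * (r y * `|w' y|))).
      by rewrite mulrA ler_wpM2r// G'_le.
    by rewrite ler_wpM2l ?mulr_ge0//; exact: radial_weight'_le.
  have h2 : `|G y * w'' y| <= B * ((3 * L + L ^+ 2) * r y `^ (- gam)).
    rewrite normrM; apply: (@le_trans _ _ (B * (r y ^+ 2 * `|w'' y|))).
      by rewrite mulrA ler_wpM2r// G_le.
    by rewrite ler_wpM2l//; exact: radial_weight''_le.
  apply: le_trans (ler_normD _ _) _.
  apply: le_trans (lerD (ler_normD _ _) (ler_normD _ _)) _.
  lra.
Qed.

End even_extension_interp.

(** * Partial derivatives and bilinear interpolation *)

Section partial_derivatives.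
Context {R : realType}.
Implicit Types u : R * R -> R.

Lemma is_derive_horizontal u (t y : R) : derivable u (t, y) (1, 0) ->
  is_derive t 1 (fun s => u (s, y)) ('D_(1, 0) u (t, y)).
Proof.
move=> du; have e : (fun h : R => h^-1 *: (u (h *: (1, 0) + (t, y)) - u (t, y))) =
    (fun h : R => h^-1 *: (u (h *: 1 + t, y) - u (t, y))).
  apply/funext => h; congr (_ *: (u _ - _)).
  by congr (_, _); rewrite /= /GRing.scale/= mulr0 add0r.
by apply: DeriveDef; [move: du|]; rewrite /derivable /derive e.
Qed.

Lemma is_derive_vertical u (x t : R) : derivable u (x, t) (0, 1) ->
  is_derive t 1 (fun s => u (x, s)) ('D_(0, 1) u (x, t)).
Proof.
move=> du; have e : (fun h : R => h^-1 *: (u (h *: (0, 1) + (x, t)) - u (x, t))) =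
    (fun h : R => h^-1 *: (u (x, h *: 1 + t) - u (x, t))).
  apply/funext => h; congr (_ *: (u _ - _)).
  by congr (_, _); rewrite /= /GRing.scale/= mulr0 add0r.
by apply: DeriveDef; [move: du|]; rewrite /derivable /derive e.
Qed.

Lemma continuous_bounded_on_square u (K : R) : 0 <= K -> continuous u ->
  exists2 M, 0 <= M & forall x y, - K <= x <= K -> - K <= y <= K ->
    `|u (x, y)| <= M.
Proof.
move=> K0 cu.
pose S : set (R * R) := `[- K, K]%classic `*` `[- K, K]%classic.
have cS : compact S by apply: compact_setX; exact: segment_compact.
have [|||c cS' hc] := @compact_EVT_max _ R (fun p => `|u p|) S.
- by exists (0, 0); split; rewrite /= in_itv/= oppr_le0 K0.
- exact: cS.
- apply: continuous_subspaceT => p; apply: continuous_comp; first exact: cu.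
  exact: norm_continuous.
exists `|u c|; first by [].
by move=> x y hx hy; apply: hc; rewrite inE; split; rewrite /= in_itv.
Qed.

(** Interpolate in the first variable at height [y], then in the second on the edges [a] and [b].
    The second error is a convex combination of the two edge errors, so it is at most [E2], and no
    mixed derivative appears. *)
Lemma bilinear_interp_error (f : R * R -> R) (a b c d E1 E2 : R) :
  a < b -> c < d ->
  (forall x y, a <= x <= b -> c <= y <= d ->
    `|f (x, y) - (f (a, y) * (b - x) + f (b, y) * (x - a)) / (b - a)| <= E1) ->
  (forall x y, a <= x <= b -> c <= y <= d ->
    `|f (x, y) - (f (x, c) * (d - y) + f (x, d) * (y - c)) / (d - c)| <= E2) ->
  forall x y, a <= x <= b -> c <= y <= d ->
  `|f (x, y) - bilinear_interp f a b c d (x, y)| <= E1 + E2.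
Proof.
move=> ab cd h1 h2 x y xab ycd.
have ba : 0 < b - a by lra.
have dc : 0 < d - c by lra.
pose la := (b - x) / (b - a); pose lb := (x - a) / (b - a).
have la0 : 0 <= la by rewrite divr_ge0//; lra.
have lb0 : 0 <= lb by rewrite divr_ge0//; lra.
have lab : la + lb = 1 by rewrite /la /lb; field; lra.
pose e0 := f (x, y) - (f (a, y) * (b - x) + f (b, y) * (x - a)) / (b - a).
pose e1 := f (a, y) - (f (a, c) * (d - y) + f (a, d) * (y - c)) / (d - c).
pose e2 := f (b, y) - (f (b, c) * (d - y) + f (b, d) * (y - c)) / (d - c).
have -> : f (x, y) - bilinear_interp f a b c d (x, y) = e0 + (la * e1 + lb * e2).
  rewrite /bilinear_interp /e0 /e1 /e2 /la /lb /=; field.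
  by rewrite !gt_eqF.
apply: le_trans (ler_normD _ _) _; apply: lerD; first exact: h1.
have k1 : `|e1| <= E2 by apply: h2 => //; rewrite lexx ltW.
have k2 : `|e2| <= E2 by apply: h2 => //; rewrite lexx ltW.
clearbody la lb.
apply: le_trans (ler_normD _ _) _; rewrite !normrM (ger0_norm la0) (ger0_norm lb0).
have : la * `|e1| <= la * E2 by rewrite ler_wpM2l.
have : lb * `|e2| <= lb * E2 by rewrite ler_wpM2l.
have -> : la = 1 - lb by lra.
lra.
Qed.

End partial_derivatives.

Section finite_difference_bounds.
Context {R : realType}.
Variables (u ux uxx uy uyy : R * R -> R) (l M : R).
Hypothesis l0 : 0 < l.
Hypotheses
  (dx : forall x y : R, is_derive x 1 (fun t => u (t, y)) (ux (x, y)))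
  (dxx : forall x y : R, is_derive x 1 (fun t => ux (t, y)) (uxx (x, y)))
  (dy : forall x y : R, is_derive y 1 (fun t => u (x, t)) (uy (x, y)))
  (dyy : forall x y : R, is_derive y 1 (fun t => uy (x, t)) (uyy (x, y))).
Hypotheses
  (uxxM : forall x y, - (3 * l) <= x <= 3 * l -> - (3 * l) <= y <= 3 * l ->
    `|uxx (x, y)| <= M)
  (uyyM : forall x y, - (3 * l) <= x <= 3 * l -> - (3 * l) <= y <= 3 * l ->
    `|uyy (x, y)| <= M).

(** Origin of the square of half-width [3 * l]: a point of the closure of Omega is displaced by at
    most [2 * l] in each coordinate. *)
Let stencil_range (x a t : R) : - l <= x <= l -> 0 <= a <= 2 * l ->
  x - a <= t <= x + a -> - (3 * l) <= t <= 3 * l.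
Proof. by move: l0; lra. Qed.

Let center_range (x t : R) : - l <= x <= l -> 0 <= t <= 2 * l ->
  - (3 * l) <= x - t <= 3 * l /\ - (3 * l) <= x + t <= 3 * l.
Proof. by move: l0; split; lra. Qed.

(** [fd_g] is the sum of two horizontal second differences, at heights [y + t] and [y - t], and
    twice the vertical one through [p]. This gives [4 * M * s ^+ 2 + 4 * M * t ^+ 2]. *)
Lemma fd_g_le p q : - l <= p.1 <= l -> - l <= p.2 <= l ->
  0 <= q.1 <= 2 * l -> 0 <= q.2 <= 2 * l ->
  `|fd_g u p q| <= 4 * M * enorm q ^+ 2.
Proof.
case: p => x y; case: q => s t /= xl yl sl tl; rewrite sqr_enorm/=.
have [h1 h2] := center_range yl tl.
have s0 : 0 <= s by lra.
have t0 : 0 <= t by lra.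
have k1 := @second_difference_bound R (fun z => u (z, y + t)) (fun z => ux (z, y + t))
  (fun z => uxx (z, y + t)) x s M s0 (fun z _ => dx z (y + t)) (fun z _ => dxx z (y + t))
  (fun z zI => uxxM (stencil_range xl sl zI) h2).
have k2 := @second_difference_bound R (fun z => u (z, y - t)) (fun z => ux (z, y - t))
  (fun z => uxx (z, y - t)) x s M s0 (fun z _ => dx z (y - t)) (fun z _ => dxx z (y - t))
  (fun z zI => uxxM (stencil_range xl sl zI) h1).
have x3 : - (3 * l) <= x <= 3 * l by move: l0; lra.
have k3 := @second_difference_bound R (fun z => u (x, z)) (fun z => uy (x, z))
  (fun z => uyy (x, z)) y t M t0 (fun z _ => dy x z) (fun z _ => dyy x z)
  (fun z zI => uyyM x3 (stencil_range yl tl zI)).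
have -> : fd_g u (x, y) (s, t) =
   (u (x + s, y + t) + u (x - s, y + t) - 2 * u (x, y + t)) +
   (u (x + s, y - t) + u (x - s, y - t) - 2 * u (x, y - t)) +
   2 * (u (x, y + t) + u (x, y - t) - 2 * u (x, y)).
  by rewrite /fd_g/=; ring.
apply: le_trans (ler_normD _ _) _.
apply: le_trans (lerD (ler_normD _ _) (lexx _)) _.
rewrite [X in _ + X]normrM (@ger0_norm _ 2)//; lra.
Qed.

Lemma fd_phiE lam gam p q :
  fd_phi gam lam u p q =
  fd_g u p q * (expR (- (lam * enorm q)) * enorm q `^ (- gam)).
Proof. by rewrite /fd_phi invfM -expRN -powRN. Qed.

Variables (lam gam : R).
Hypotheses (lam0 : 0 <= lam) (gam0 : 0 <= gam).

Let L := lam * (4 * l) + gam.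
Let C := 4 * M + 8 * M * L + 4 * M * (3 * L + L ^+ 2).

(** A rational substitute for the diagonal [2 * sqrt 2 * l]; it is the upper radius [R0] inside the
    constant [L]. *)
Let enorm_le s t : 0 <= s <= 2 * l -> 0 <= t <= 2 * l -> enorm (s, t) <= 4 * l.
Proof.
move=> sl tl; rewrite -(@ler_pXn2r _ 2) ?nnegrE ?enorm_ge0//; last by move: l0; lra.
rewrite sqr_enorm/= exprMn.
have : s ^+ 2 <= (2 * l) ^+ 2 by rewrite lerXn2r ?nnegrE; move: l0; lra.
have : t ^+ 2 <= (2 * l) ^+ 2 by rewrite lerXn2r ?nnegrE; move: l0; lra.
rewrite exprMn; have := sqr_ge0 l; lra.
Qed.

Lemma fd_phi_interp_error p a b c d rho :
  - l <= p.1 <= l -> - l <= p.2 <= l ->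
  0 <= a -> a < b -> b <= 2 * l -> 0 <= c -> c < d -> d <= 2 * l -> 0 < rho ->
  (forall s t, a <= s <= b -> c <= t <= d -> rho <= enorm (s, t)) ->
  forall s t, a <= s <= b -> c <= t <= d ->
  `|fd_phi gam lam u p (s, t) - bilinear_interp (fd_phi gam lam u p) a b c d (s, t)|
    <= C * rho `^ (- gam) * (b - a) ^+ 2 + C * rho `^ (- gam) * (d - c) ^+ 2.
Proof.
case: p => x y /= xl yl a0 ab bl c0 cd dl rho0 rhoP.
apply: bilinear_interp_error => // s t sab tcd.
- have tl : 0 <= t <= 2 * l by lra.
  have [h1 h2] := center_range yl tl.
  have bI : 0 <= b <= 2 * l by lra.
  have E (z : R) : fd_phi gam lam u (x, y) (z, t) =
    (u (x + z, y + t) + u (x - z, y + t) + (u (x + z, y - t) + u (x - z, y - t))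
      + - 4 * u (x, y)) * radial_weight lam gam t z.
    by rewrite fd_phiE /radial_weight /enorm /fd_g /=; congr (_ * _); ring.
  rewrite !E.
  (* The parameter [B] is the constant [4 * M] of [fd_g_le], which explains the last summand of
     [C]. *)
  apply: (@even_extension_interp_error R (fun z => u (z, y + t)) (fun z => ux (z, y + t))
    (fun z => uxx (z, y + t)) (fun z => u (z, y - t)) (fun z => ux (z, y - t))
    (fun z => uxx (z, y - t)) x (- 4 * u (x, y)) lam gam t a b M (4 * M) (4 * l) rho) => //.
  + by move=> z zI; apply: uxxM => //; exact: stencil_range zI.
  + by move=> z zI; apply: uxxM => //; exact: stencil_range zI.
  + move=> z zI; rewrite -/(enorm (z, t)) rhoP//=; apply: enorm_le => //; lra.
  + move=> z zI; have := @fd_g_le (x, y) (z, t) xl yl.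
    have zl : 0 <= z <= 2 * l by lra.
    move=> /(_ zl tl); rewrite /fd_g /=; apply: le_trans; rewrite le_eqVlt; apply/predU1P; left; congr (`| _ |).
    by ring.
- have sl : 0 <= s <= 2 * l by lra.
  have [h1 h2] := center_range xl sl.
  have dI : 0 <= d <= 2 * l by lra.
  have E (z : R) : fd_phi gam lam u (x, y) (s, z) =
    (u (x + s, y + z) + u (x + s, y - z) + (u (x - s, y + z) + u (x - s, y - z))
      + - 4 * u (x, y)) * radial_weight lam gam s z.
    rewrite fd_phiE /radial_weight /enorm /fd_g /= [s ^+ 2 + _]addrC.
    by congr (_ * _); ring.
  rewrite !E.
  apply: (@even_extension_interp_error R (fun z => u (x + s, z)) (fun z => uy (x + s, z))
    (fun z => uyy (x + s, z)) (fun z => u (x - s, z)) (fun z => uy (x - s, z))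
    (fun z => uyy (x - s, z)) y (- 4 * u (x, y)) lam gam s c d M (4 * M) (4 * l) rho) => //.
  + by move=> z zI; apply: uyyM => //; exact: stencil_range zI.
  + by move=> z zI; apply: uyyM => //; exact: stencil_range zI.
  + move=> z zI; rewrite addrC -/(enorm (s, z)) rhoP//=; apply: enorm_le => //; lra.
  + move=> z zI; have := @fd_g_le (x, y) (s, z) xl yl.
    have zl : 0 <= z <= 2 * l by lra.
    move=> /(_ sl zl); rewrite /fd_g /enorm/= [s ^+ 2 + _]addrC.
    apply: le_trans; rewrite le_eqVlt; apply/predU1P; left; congr (`| _ |).
    by ring.
Qed.

End finite_difference_bounds.

Lemma of_class_C2_partials (R : realType) (u : R * R -> R) (l : R) :
  0 < l -> of_class_C 2 u ->
  exists ux uxx uy uyy M, [/\ 0 <= M,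
    (forall x y : R, is_derive x 1 (fun t => u (t, y)) (ux (x, y))) /\
    (forall x y : R, is_derive x 1 (fun t => ux (t, y)) (uxx (x, y))),
    (forall x y : R, is_derive y 1 (fun t => u (x, t)) (uy (x, y))) /\
    (forall x y : R, is_derive y 1 (fun t => uy (x, t)) (uyy (x, y))),
    (forall x y, - (3 * l) <= x <= 3 * l -> - (3 * l) <= y <= 3 * l ->
      `|uxx (x, y)| <= M) &
    (forall x y, - (3 * l) <= x <= 3 * l -> - (3 * l) <= y <= 3 * l ->
      `|uyy (x, y)| <= M)].
Proof.
move=> l0 [_ [d1 d2 [_ [d11 _ [cxx _] _]] [_ [_ d22 _ [cyy _]]]]].
have l30 : 0 <= 3 * l by lra.
have [M1 M10 hM1] := continuous_bounded_on_square l30 cxx.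
have [M2 M20 hM2] := continuous_bounded_on_square l30 cyy.
exists ('D_(1, 0) u), ('D_(1, 0) ('D_(1, 0) u)), ('D_(0, 1) u),
  ('D_(0, 1) ('D_(0, 1) u)), (M1 + M2); split; first exact: addr_ge0.
- by split=> x y; exact: is_derive_horizontal.
- by split=> x y; exact: is_derive_vertical.
- by move=> x y hx hy; apply: le_trans (hM1 _ _ hx hy) _; rewrite lerDl.
- by move=> x y hx hy; apply: le_trans (hM2 _ _ hx hy) _; rewrite lerDr.
Qed.

(** * Decompositions of real-valued integrals *)

Section real_valued_integrals.
Context d (T : measurableType d) (R : realType).
Variable mu : {measure set T -> \bar R}.
Implicit Types (A B D N : set T) (f g : T -> R).

Lemma integrable_of_le D f g : measurable D -> measurable_fun setT f ->
  (forall x, D x -> `|f x| <= g x) ->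
  mu.-integrable D (EFin \o g) -> mu.-integrable D (EFin \o f).
Proof.
move=> mD mf fg; apply: le_integrable => //.
  by apply/measurable_EFinP; exact: measurable_funTS.
by move=> x Dx; rewrite lee_fin (le_trans (fg _ Dx))// ler_norm.
Qed.

Lemma integrable_setU A B f : measurable A -> measurable B ->
  measurable_fun setT f ->
  mu.-integrable A (EFin \o f) -> mu.-integrable B (EFin \o f) ->
  mu.-integrable (A `|` B) (EFin \o f).
Proof.
move=> mA mB mf /integrableP[_ iA] /integrableP[_ iB].
have mnf D : measurable_fun D (fun x => `|(EFin \o f) x|%E).
  by apply: measurableT_comp => //; apply: measurable_funTS; exact/measurable_EFinP.
apply/integrableP; split; first by apply: measurable_funTS; exact/measurable_EFinP.
have -> : A `|` B = A `|` (B `\` A).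
  apply/seteqP; split => x [Ax|Bx]; [by left| |by left|by right; case: Bx].
  by have [Ax|nAx] := pselect (A x); [left|right].
have mBA : measurable (B `\` A) by exact: measurableD.
rewrite ge0_integral_setU//; last by apply/disj_setPS => x [? []].
apply: lte_add_pinfty => //; apply: le_lt_trans iB.
by apply: ge0_subset_integral => // x [].
Qed.

(** The bound on the extended integral of [g] is finite, hence it also supplies the integrability of
    [f] that a real-valued integral calls for. *)
Lemma normr_Rintegral_le D f g (C : R) : measurable D -> measurable_fun setT f ->
  measurable_fun setT g -> (forall x, D x -> `|f x| <= g x) ->
  (\int[mu]_(x in D) (g x)%:E <= C%:E)%E -> `|\int[mu]_(x in D) f x| <= C.
Proof.
move=> mD mf mg fg gC.
have mEf : measurable_fun D (fun x => (f x)%:E).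
  by apply: measurable_funTS; exact/measurable_EFinP.
have mEg : measurable_fun D (fun x => (g x)%:E).
  by apply: measurable_funTS; exact/measurable_EFinP.
have h1 : (\int[mu]_(x in D) `|(f x)%:E| <= C%:E)%E.
  apply: le_trans gC; apply: ge0_le_integral => //.
  exact: measurableT_comp.
have fi : mu.-integrable D (EFin \o f).
  apply/integrableP; split => //.
  by apply: le_lt_trans h1 _; exact: ltry.
rewrite -lee_fin EFin_normr_Rintegral//.
by apply: le_trans h1; exact: le_abse_integral.
Qed.

Lemma integral_subset_le D1 D2 f (C : R) : measurable D1 -> measurable D2 ->
  measurable_fun setT f -> (forall x, 0 <= f x) -> D1 `<=` D2 ->
  (\int[mu]_(x in D2) (f x)%:E <= C%:E)%E -> (\int[mu]_(x in D1) (f x)%:E <= C%:E)%E.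
Proof.
move=> m1 m2 mf f0 D12; apply: le_trans; apply: ge0_subset_integral => //.
- by apply: measurable_funTS; exact/measurable_EFinP.
- by move=> x _; rewrite lee_fin.
Qed.

(** With nested domains each induction step is a single disjoint union; vertical and horizontal
    strips are both instances. *)
Lemma Rintegral_telescope (D : nat -> set T) f (n : nat) :
  (forall i, measurable (D i)) -> nondecreasing_seq D -> D 0%N = set0 ->
  mu.-integrable (D n) (EFin \o f) ->
  \int[mu]_(x in D n) f x = \sum_(i < n) \int[mu]_(x in D i.+1 `\` D i) f x.
Proof.
move=> mD ndD D0; elim: n => [|n IHn] fi.
  by rewrite D0 Rintegral_set0 big_ord0.
have sD : D n `<=` D n.+1 by rewrite -subsetEset; exact: ndD.
rewrite big_ord_recr/= -IHn; last exact: (integrableS _ _ sD).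
rewrite -Rintegral_setU//; last 3 first.
- exact: measurableD.
- by rewrite setDUK.
- by apply/disj_setPS => x [? []].
by rewrite setDUK.
Qed.

End real_valued_integrals.

(** * Decomposition of a square into grid cells *)

Section grid.
Context {R : realType}.
Implicit Types (f : R * R -> R) (a : nat -> R) (A B : set R).
Let RR := (measurableTypeR R * measurableTypeR R)%type.

Lemma Rintegral_strips_fst a B f (n : nat) : nondecreasing_seq a -> measurable B ->
  (lebesgue2 R).-integrable (`]a 0%N, a n] `*` B) (EFin \o f) ->
  \int[lebesgue2 R]_(z in `]a 0%N, a n] `*` B) f z =
  \sum_(i < n) \int[lebesgue2 R]_(z in `]a i, a i.+1] `*` B) f z.
Proof.
move=> nda mB fi.
pose D i : set RR := `]a 0%N, a i]%classic `*` B.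
rewrite -[LHS]/(\int[lebesgue2 R]_(z in D n) f z) Rintegral_telescope//.
- apply: eq_bigr => i _; congr Rintegral.
  apply/seteqP; split => [[x y]|[x y]]; rewrite /D/= !in_itv/=.
    move=> [[/andP[h1 h2] By] nD]; split => //; rewrite h2 andbT ltNge.
    by apply/negP => h; apply: nD; split => //; rewrite h1.
  move=> [/andP[h1 h2] By]; rewrite h2; split; first split => //.
    by rewrite (le_lt_trans _ h1)//; exact: nda.
  by rewrite (leNgt x) h1 andbF => -[].
- by move=> i; apply: measurableX => //; exact: measurable_itv.
- move=> i j ij; rewrite subsetEset => -[x y] [/= + By]; rewrite !in_itv/=.
  move=> /andP[h1 h2]; split => //=; rewrite in_itv/= h1 (le_trans h2)//; exact: nda.
- by rewrite /D set_itvoc0 set0X.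
Qed.

Lemma Rintegral_strips_snd a A f (n : nat) : nondecreasing_seq a -> measurable A ->
  (lebesgue2 R).-integrable (A `*` `]a 0%N, a n]) (EFin \o f) ->
  \int[lebesgue2 R]_(z in A `*` `]a 0%N, a n]) f z =
  \sum_(i < n) \int[lebesgue2 R]_(z in A `*` `]a i, a i.+1]) f z.
Proof.
move=> nda mA fi.
pose D i : set RR := A `*` `]a 0%N, a i]%classic.
rewrite -[LHS]/(\int[lebesgue2 R]_(z in D n) f z) Rintegral_telescope//.
- apply: eq_bigr => i _; congr Rintegral.
  apply/seteqP; split => [[x y]|[x y]]; rewrite /D/= !in_itv/=.
    move=> [[Ax /andP[h1 h2]] nD]; split => //; rewrite h2 andbT ltNge.
    by apply/negP => h; apply: nD; split => //; rewrite h1.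
  move=> [Ax /andP[h1 h2]]; rewrite h2; split; first split => //.
    by rewrite (le_lt_trans _ h1)//; exact: nda.
  by rewrite (leNgt y) h1 andbF => -[].
- by move=> i; apply: measurableX => //; exact: measurable_itv.
- move=> i j ij; rewrite subsetEset => -[x y] [/= Ax]; rewrite !in_itv/=.
  move=> /andP[h1 h2]; split => //=; rewrite in_itv/= h1 (le_trans h2)//; exact: nda.
- by rewrite /D set_itvoc0 setX0.
Qed.

Lemma Rintegral_grid a f (n : nat) : nondecreasing_seq a ->
  (lebesgue2 R).-integrable (`]a 0%N, a n] `*` `]a 0%N, a n]) (EFin \o f) ->
  \int[lebesgue2 R]_(z in `]a 0%N, a n] `*` `]a 0%N, a n]) f z =
  \sum_(i < n) \sum_(j < n)
    \int[lebesgue2 R]_(z in `]a i, a i.+1] `*` `]a j, a j.+1]) f z.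
Proof.
move=> nda fi; rewrite Rintegral_strips_fst//.
apply: eq_bigr => i _; apply: Rintegral_strips_snd => //.
apply: integrableS fi.
- by apply: measurableX; exact: measurable_itv.
- by apply: measurableX; exact: measurable_itv.
- move=> [x y] [/=]; rewrite !in_itv/= => /andP[h1 h2] h3; split => //=.
  rewrite ?in_itv/=; apply/andP; split.
    by apply: le_lt_trans h1; exact: nda.
  by apply: le_trans h2 _; apply: nda.
Qed.

Lemma measurable_vline (b : R) : measurable ([set z | z.1 = b] : set RR).
Proof.
have -> : [set z : R * R | z.1 = b] = [set b] `*` setT.
  by apply/seteqP; split => -[x y]//= [].
by apply: measurableX => //; exact: measurable_set1.
Qed.

Lemma measurable_hline (b : R) : measurable ([set z | z.2 = b] : set RR).
Proof.
have -> : [set z : R * R | z.2 = b] = setT `*` [set b].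
  by apply/seteqP; split => -[x y]//= [].
by apply: measurableX => //; exact: measurable_set1.
Qed.

(** One null-set argument for all boundary adjustments: closed against half-open cells, and open
    against closed half-planes and quadrants. *)
Lemma Rintegral_mod_lines (b d : R) (D1 D2 : set (R * R)) f :
  measurable (D1 : set RR) -> measurable (D2 : set RR) ->
  measurable_fun setT f ->
  (forall z, z.1 <> b -> z.2 <> d -> D1 z <-> D2 z) ->
  \int[lebesgue2 R]_(z in D1) f z = \int[lebesgue2 R]_(z in D2) f z.
Proof.
move=> mD1 mD2 mf DD; rewrite /Rintegral; congr fine.
apply: (@integral_eq_mod_null _ RR R (lebesgue2 R) _ _
  ([set z | z.1 = b] `|` [set z | z.2 = d])) => //.
- by apply: measurableU; [exact: measurable_vline|exact: measurable_hline].
- apply/eqP; rewrite -measure_le0.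
  apply: le_trans (measureU2 _ (measurable_vline b) (measurable_hline d)) _.
  by rewrite [X in (X + _)%E]lebesgue2_vline [X in (_ + X)%E]lebesgue2_hline adde0.
- by apply/seteqP; split => z [Dz nz]; split => //; apply/DD => // e; apply: nz; [left|right|left|right].
Qed.

(** The scheme integrates over closed cells, which overlap; half-open ones tile the square and avoid
    the axes. *)
Lemma Rintegral_closed_cell (b c d e : R) f : measurable_fun setT f ->
  \int[lebesgue2 R]_(z in `[b, c] `*` `[d, e]) f z =
  \int[lebesgue2 R]_(z in `]b, c] `*` `]d, e]) f z.
Proof.
move=> mf; apply: (@Rintegral_mod_lines b d) => //.
- by apply: measurableX; exact: measurable_itv.
- by apply: measurableX; exact: measurable_itv.
- move=> [x y]/= xb yd; rewrite !in_itv/= !lt_neqAle.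
  by rewrite (introF eqP (nesym xb)) (introF eqP (nesym yd)).
Qed.

End grid.

(** * Integrals of even functions over half-planes *)

Section even_integrands.
Context {R : realType}.
Implicit Types (D : set (R * R)) (F : R * R -> R).
Let RR := (measurableTypeR R * measurableTypeR R)%type.

Lemma measurable_halfplane_fst : measurable ([set z | 0 < z.1] : set RR).
Proof.
have -> : [set z : R * R | 0 < z.1] = `]0, +oo[%classic `*` setT.
  by apply/seteqP; split => -[x y]/=; rewrite in_itv/= andbT// => -[].
by apply: measurableX => //; exact: measurable_itv.
Qed.

Lemma measurable_halfplane_snd : measurable ([set z | 0 < z.2] : set RR).
Proof.
have -> : [set z : R * R | 0 < z.2] = setT `*` `]0, +oo[%classic.
  by apply/seteqP; split => -[x y]/=; rewrite in_itv/= andbT// => -[].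
by apply: measurableX => //; exact: measurable_itv.
Qed.

Lemma lebesgue2_reflection_fst (X : set (R * R)) : measurable X ->
  (lebesgue2 R) ((fun z => (- z.1, z.2)) @^-1` X) = (lebesgue2 R) X.
Proof.
move=> mX; apply: (@lebesgue2_preimage R -%R id) => //; exact: lebesgue_measureN.
Qed.

Lemma lebesgue2_reflection_snd (X : set (R * R)) : measurable X ->
  (lebesgue2 R) ((fun z => (z.1, - z.2)) @^-1` X) = (lebesgue2 R) X.
Proof.
move=> mX; apply: (@lebesgue2_preimage R id -%R) => //; exact: lebesgue_measureN.
Qed.

Lemma Rintegral_even_fst D F : measurable (D : set RR) -> measurable_fun setT F ->
  (lebesgue2 R).-integrable D (EFin \o F) ->
  (forall x y, D (- x, y) <-> D (x, y)) -> (forall x y, F (- x, y) = F (x, y)) ->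
  \int[lebesgue2 R]_(z in D) F z =
  2 * \int[lebesgue2 R]_(z in D `&` [set z | 0 < z.1]) F z.
Proof.
move=> mD mF iF DN FN.
have mP := measurable_halfplane_fst.
have mDP : measurable (D `&` [set z | 0 < z.1] : set RR) by exact: measurableI.
have mDN : measurable (D `\` [set z | 0 < z.1] : set RR) by exact: measurableD.
rewrite -{1}(setUIDK D [set z | 0 < z.1]).
rewrite Rintegral_setU//; last 2 first.
- by rewrite setUIDK.
- by apply/disj_setPS => z [[_ ?] [_ ]].
rewrite mulr2n mulrDl mul1r; congr (_ + _).
have mrefl : measurable_fun [set: RR] (fun z : RR => (- z.1, z.2) : RR).
  apply/measurable_fun_pair; last exact: measurable_snd.
  by apply: measurableT_comp; [exact: oppr_measurable|exact: measurable_fst].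
rewrite [RHS]/Rintegral (@integral_preimage _ RR R (lebesgue2 R) (fun z => (- z.1, z.2)))//; last first.
  exact: lebesgue2_reflection_fst.
rewrite (_ : (fun z => _) = (fun z => (F z)%:E)); last by apply/funext => -[x y]; rewrite FN.
rewrite -[RHS]/(\int[lebesgue2 R]_(z in _) F z).
(* The complement of the open half-plane contains the axis, the reflected open half-plane does
   not. *)
apply: (@Rintegral_mod_lines R 0 0) => //.
- by rewrite -[X in measurable X]setTI; exact: mrefl.
- move=> [x y]/= x0 _; rewrite oppr_gt0; split => -[h1 h2]; split.
  + exact/DN.
  + by move/negP: h2; rewrite -leNgt le_eqVlt => /predU1P[].
  + exact/DN.
  + by apply/negP; rewrite -leNgt ltW.
Qed.

Lemma Rintegral_even_snd D F : measurable (D : set RR) -> measurable_fun setT F ->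
  (lebesgue2 R).-integrable D (EFin \o F) ->
  (forall x y, D (x, - y) <-> D (x, y)) -> (forall x y, F (x, - y) = F (x, y)) ->
  \int[lebesgue2 R]_(z in D) F z =
  2 * \int[lebesgue2 R]_(z in D `&` [set z | 0 < z.2]) F z.
Proof.
move=> mD mF iF DN FN.
have mP := measurable_halfplane_snd.
have mDP : measurable (D `&` [set z | 0 < z.2] : set RR) by exact: measurableI.
have mDN : measurable (D `\` [set z | 0 < z.2] : set RR) by exact: measurableD.
rewrite -{1}(setUIDK D [set z | 0 < z.2]).
rewrite Rintegral_setU//; last 2 first.
- by rewrite setUIDK.
- by apply/disj_setPS => z [[_ ?] [_ ]].
rewrite mulr2n mulrDl mul1r; congr (_ + _).
have mrefl : measurable_fun [set: RR] (fun z : RR => (z.1, - z.2) : RR).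
  apply/measurable_fun_pair; first exact: measurable_fst.
  by apply: measurableT_comp; [exact: oppr_measurable|exact: measurable_snd].
rewrite [RHS]/Rintegral (@integral_preimage _ RR R (lebesgue2 R) (fun z => (z.1, - z.2)))//; last first.
  exact: lebesgue2_reflection_snd.
rewrite (_ : (fun z => _) = (fun z => (F z)%:E)); last by apply/funext => -[x y]; rewrite FN.
rewrite -[RHS]/(\int[lebesgue2 R]_(z in _) F z).
apply: (@Rintegral_mod_lines R 0 0) => //.
- by rewrite -[X in measurable X]setTI; exact: mrefl.
- move=> [x y]/= _ y0; rewrite oppr_gt0; split => -[h1 h2]; split.
  + exact/DN.
  + by move/negP: h2; rewrite -leNgt le_eqVlt => /predU1P[].
  + exact/DN.
  + by apply/negP; rewrite -leNgt ltW.
Qed.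

End even_integrands.
(** * The principal value as an integral over a quadrant *)

Section tempered_kernel_section.
Context {R : realType}.
Variables (beta lam : R).
Hypotheses (beta02 : 0 < beta < 2) (lam0 : 0 <= lam).
Let RR := (measurableTypeR R * measurableTypeR R)%type.

Definition tempered_kernel (z : R * R) : R := (expR (lam * enorm z) * enorm z `^ (2 + beta))^-1.

(** At the origin both sides are 0, by the conventions that the inverse of 0 is 0 and that a nonzero
    power of 0 is 0. *)
Lemma tempered_kernelE z : tempered_kernel z = expR (- (lam * enorm z)) * enorm z `^ (- (2 + beta)).
Proof. by rewrite /tempered_kernel invfM -expRN -powRN. Qed.

Lemma tempered_kernel_ge0 z : 0 <= tempered_kernel z.
Proof. by rewrite tempered_kernelE mulr_ge0 ?expR_ge0 ?powR_ge0. Qed.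

Lemma tempered_kernel_le z : tempered_kernel z <= enorm z `^ (- (2 + beta)).
Proof.
rewrite tempered_kernelE ler_piMl ?powR_ge0// -expR0 ler_expR oppr_le0.
by rewrite mulr_ge0// enorm_ge0.
Qed.

Lemma measurable_tempered_kernel : measurable_fun setT tempered_kernel.
Proof.
rewrite (_ : tempered_kernel = (fun z => expR (- (lam * enorm z)) * enorm z `^ (- (2 + beta)))); last first.
  by apply/funext => z; exact: tempered_kernelE.
apply: measurable_funM; last by apply: measurable_fun_powR; exact: measurable_enorm.
apply: measurable_fun_expR; apply: measurableT_comp; first exact: oppr_measurable.
by apply: measurable_funM => //; exact: measurable_enorm.
Qed.

Lemma measurable_enorm_gt (e : R) : measurable ([set z : R * R | e < enorm z] : set RR).
Proof.
have -> : [set z : R * R | e < enorm z] = enorm @^-1` `]e, +oo[%classic.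
  by apply/seteqP; split => z/=; rewrite in_itv/= andbT.
rewrite -[X in measurable X]setTI.
exact: measurable_enorm.
Qed.

Lemma integrable_tempered_kernel_far (e : R) : 0 < e ->
  (lebesgue2 R).-integrable [set z | e < enorm z] (EFin \o tempered_kernel).
Proof.
move=> e0; have b0 : 0 < beta by move: beta02; lra.
apply: integrable_of_le (integrable_enorm_far b0 e0).
- exact: measurable_enorm_gt.
- exact: measurable_tempered_kernel.
- by move=> z _; rewrite ger0_norm ?tempered_kernel_ge0// tempered_kernel_le.
Qed.

End tempered_kernel_section.

Section principal_value.
Context {R : realType}.
Variables (beta lam : R).
Hypotheses (beta02 : 0 < beta < 2) (lam0 : 0 <= lam).
Variables (u : R * R -> R) (M0 : R).
Hypotheses (cu : continuous u) (uM0 : forall z, `|u z| <= M0).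
Let RR := (measurableTypeR R * measurableTypeR R)%type.
Local Notation K := (tempered_kernel beta lam).

Lemma measurable_comp2 (f1 f2 : R * R -> R) :
  measurable_fun setT f1 -> measurable_fun setT f2 ->
  measurable_fun setT (fun z => u (f1 z, f2 z)).
Proof.
move=> m1 m2; apply: (@measurableT_comp _ _ _ _ _ _ u _ (fun z => (f1 z, f2 z))).
  exact: continuous_measurable_fun2.
exact: measurable_fun_pair.
Qed.

Lemma measurable_fd_g p : measurable_fun setT (fd_g u p).
Proof.
rewrite /fd_g; apply: measurable_funB => //.
by do ?[apply: measurable_funD]; apply: measurable_comp2;
  first [exact: measurable_funD | exact: measurable_funB].
Qed.

Lemma fd_g_even_fst p x y : fd_g u p (- x, y) = fd_g u p (x, y).
Proof. by rewrite /fd_g/= opprK; ring. Qed.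

Lemma fd_g_even_snd p x y : fd_g u p (x, - y) = fd_g u p (x, y).
Proof. by rewrite /fd_g/= opprK; ring. Qed.

Lemma fd_g_bounded p z : `|fd_g u p z| <= 8 * M0.
Proof.
rewrite /fd_g.
apply: le_trans (ler_normB _ _) _; rewrite [X in _ + X]normrM (@ger0_norm _ 4)//.
have h := uM0 p.
apply: (@le_trans _ _ (M0 + M0 + M0 + M0 + 4 * `|u p|)); last lra.
rewrite lerD2r.
do 3! (apply: le_trans (ler_normD _ _) _; apply: lerD => //).
Qed.

Let F p z := fd_g u p z * K z.

Lemma measurable_fd_g_kernel p : measurable_fun setT (F p).
Proof.
by apply: measurable_funM; [exact: measurable_fd_g|exact: measurable_tempered_kernel].
Qed.

Lemma integrable_fd_g_kernel_far p (e : R) : 0 < e ->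
  (lebesgue2 R).-integrable [set z | e < enorm z] (EFin \o F p).
Proof.
move=> e0.
apply: (integrable_of_le _ _ _ (integrableZl (measurable_enorm_gt e) (8 * M0)
  (integrable_tempered_kernel_far beta02 lam0 e0))).
- exact: measurable_enorm_gt.
- exact: measurable_fd_g_kernel.
- by move=> z _; rewrite normrM (ger0_norm (tempered_kernel_ge0 _ _ _)) ler_wpM2r ?tempered_kernel_ge0 ?fd_g_bounded.
Qed.

Let pv_integrand p y := (u p - u y) /
  (expR (lam * enorm (p - y)) * enorm (p - y) `^ (2 + beta)).

(** Substitution [y = (f1 z.1, f2 z.2)], to be used with each [f] equal to [p.i + t] or [p.i - t].
    The two square identities say that [enorm (p - y) = enorm z], so all four sign choices are
    handled at once. *)
Lemma pv_shift (f1 f2 : R -> R) p (e : R) :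
  measurable_fun setT f1 -> measurable_fun setT f2 ->
  (forall A, measurable A -> lebesgue_measure (f1 @^-1` A) = lebesgue_measure A) ->
  (forall A, measurable A -> lebesgue_measure (f2 @^-1` A) = lebesgue_measure A) ->
  (forall t, (p.1 - f1 t) ^+ 2 = t ^+ 2) ->
  (forall t, (p.2 - f2 t) ^+ 2 = t ^+ 2) ->
  \int[lebesgue2 R]_(y in [set y | e < enorm (p - y)]) pv_integrand p y =
  \int[lebesgue2 R]_(z in [set z | e < enorm z]) ((u p - u (f1 z.1, f2 z.2)) * K z).
Proof.
move=> mf1 mf2 hf1 hf2 e1 e2.
pose phi (z : R * R) := (f1 z.1, f2 z.2).
have nphi z : enorm (p - phi z) = enorm z by rewrite /enorm /= e1 e2.
have mB : measurable_fun setT (fun y : R * R => enorm (p - y)).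
  have : measurable_fun setT (enorm \o (fun y : R * R => (p.1 - y.1, p.2 - y.2))).
    apply: measurableT_comp; first exact: measurable_enorm.
    by apply: measurable_fun_pair; apply: measurable_funB.
  exact.
have mphi : measurable_fun [set: RR] (phi : RR -> RR).
  apply/measurable_fun_pair.
  - exact: (@measurableT_comp _ _ _ _ (measurableTypeR R) _ f1).
  - exact: (@measurableT_comp _ _ _ _ (measurableTypeR R) _ f2).
have mD : measurable ([set y : R * R | e < enorm (p - y)] : set RR).
  have -> : [set y : R * R | e < enorm (p - y)] = (fun y => enorm (p - y)) @^-1` `]e, +oo[%classic.
    by apply/seteqP; split => z/=; rewrite in_itv/= andbT.
  by rewrite -[X in measurable X]setTI; exact: mB.
have mI : measurable_fun [set: RR] (pv_integrand p).
  rewrite (_ : pv_integrand p = (fun y => (u p - u y) * (K \o (fun y => p - y)) y))//.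
  apply: measurable_funM; first by apply: measurable_funB => //; exact: continuous_measurable_fun2.
  apply: measurableT_comp; first exact: measurable_tempered_kernel.
  by apply: measurable_fun_pair; apply: measurable_funB.
have hphi : forall X : set RR, measurable X -> (lebesgue2 R) (phi @^-1` X) = (lebesgue2 R) X.
  exact: lebesgue2_preimage.
have h := integral_preimage mphi hphi mD mI.
apply: etrans (congr1 fine h) _.
rewrite -[LHS]/(\int[lebesgue2 R]_(z in phi @^-1` [set y | e < enorm (p - y)]) pv_integrand p (phi z)).
have -> : phi @^-1` [set y | e < enorm (p - y)] = [set z | e < enorm z].
  by apply/seteqP; split => z /=; rewrite nphi.
by apply: eq_Rintegral => z _; rewrite /pv_integrand nphi.
Qed.

Let integrable_pv (f1 f2 : R -> R) p (e : R) : 0 < e ->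
  measurable_fun setT f1 -> measurable_fun setT f2 ->
  (lebesgue2 R).-integrable [set z | e < enorm z]
    (EFin \o (fun z => (u p - u (f1 z.1, f2 z.2)) * K z)).
Proof.
move=> e0 m1 m2.
apply: (integrable_of_le _ _ _ (integrableZl (measurable_enorm_gt e) (2 * M0)
  (integrable_tempered_kernel_far beta02 lam0 e0))).
- exact: measurable_enorm_gt.
- apply: measurable_funM; last exact: measurable_tempered_kernel.
  apply: measurable_funB => //; apply: measurable_comp2.
  + by apply: measurableT_comp.
  + by apply: measurableT_comp.
- move=> z _; rewrite normrM (ger0_norm (tempered_kernel_ge0 _ _ _)) ler_wpM2r ?tempered_kernel_ge0//.
  by apply: le_trans (ler_normB _ _) _; have := uM0 p; have := uM0 (f1 z.1, f2 z.2); lra.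
Qed.

Let Rintegral_far_quadrant p (e : R) : 0 < e ->
  \int[lebesgue2 R]_(z in [set z | e < enorm z]) F p z = 4 *
  \int[lebesgue2 R]_(z in [set z | e < enorm z] `&` [set z | 0 < z.1]
       `&` [set z | 0 < z.2]) F p z.
Proof.
move=> e0; set D := [set z | e < enorm z].
have mD : measurable (D : set RR) := measurable_enorm_gt e.
have iF := integrable_fd_g_kernel_far p e0.
pose D1 := D `&` [set z | 0 < z.1].
have mF := measurable_fd_g_kernel p.
have DN1 x y : D (- x, y) <-> D (x, y) by rewrite /D/= /enorm/= sqrrN.
have DN2 x y : D1 (x, - y) <-> D1 (x, y) by rewrite /D1 /D/= /enorm/= sqrrN.
have FN1 x y : F p (- x, y) = F p (x, y).
  by rewrite /F fd_g_even_fst /tempered_kernel /enorm/= sqrrN.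
have FN2 x y : F p (x, - y) = F p (x, y).
  by rewrite /F fd_g_even_snd /tempered_kernel /enorm/= sqrrN.
have mD1 : measurable (D1 : set RR).
  by apply: measurableI; [exact: mD|exact: measurable_halfplane_fst].
have iF1 := integrableS mD mD1 (@subIsetl _ _ _) iF.
have s1 := Rintegral_even_fst mD mF iF DN1 FN1.
have s2 := Rintegral_even_snd mD1 mF iF1 DN2 FN2.
by rewrite s1 -/D1 s2 mulrA -natrM.
Qed.

(** All four sign choices give the same truncated integral, and minus the sum of the four numerators
    is [fd_g u p z]. Away from the origin the four integrands are integrable one by one, which
    justifies adding them. *)
Let pv_average p (e : R) : 0 < e ->
  - 4 * \int[lebesgue2 R]_(y in [set y | e < enorm (p - y)]) pv_integrand p y =
  \int[lebesgue2 R]_(z in [set z | e < enorm z]) F p z.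
Proof.
move=> e0; set D := [set z | e < enorm z]; set PV := \int[_]_(_ in _) pv_integrand _ _.
have mp x : measurable_fun setT (fun t : R => x + t) by exact: measurable_funD.
have mm x : measurable_fun setT (fun t : R => x - t) by exact: measurable_funB.
have hp (x : R) A : measurable A ->
    lebesgue_measure ((fun t => x + t) @^-1` A) = lebesgue_measure A.
  exact: lebesgue_measure_shift.
have hm (x : R) A : measurable A ->
    lebesgue_measure ((fun t => x - t) @^-1` A) = lebesgue_measure A.
  exact: lebesgue_measureNshift.
have qp (x t : R) : (x - (x + t)) ^+ 2 = t ^+ 2 by ring.
have qm (x t : R) : (x - (x - t)) ^+ 2 = t ^+ 2 by ring.
have e1 := pv_shift e (mp p.1) (mp p.2) (hp p.1) (hp p.2) (qp p.1) (qp p.2).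
have e2 := pv_shift e (mm p.1) (mp p.2) (hm p.1) (hp p.2) (qm p.1) (qp p.2).
have e3 := pv_shift e (mm p.1) (mm p.2) (hm p.1) (hm p.2) (qm p.1) (qm p.2).
have e4 := pv_shift e (mp p.1) (mm p.2) (hp p.1) (hm p.2) (qp p.1) (qm p.2).
have i1 := integrable_pv p e0 (mp p.1) (mp p.2).
have i2 := integrable_pv p e0 (mm p.1) (mp p.2).
have i3 := integrable_pv p e0 (mm p.1) (mm p.2).
have i4 := integrable_pv p e0 (mp p.1) (mm p.2).
have mD := measurable_enorm_gt e.
pose I f1 f2 (z : R * R) := (u p - u (f1 z.1, f2 z.2)) * K z.
pose I1 := I (+%R p.1) (+%R p.2); pose I2 := I (fun t => p.1 - t) (+%R p.2).
pose I3 := I (fun t => p.1 - t) (fun t => p.2 - t).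
pose I4 := I (+%R p.1) (fun t => p.2 - t).
have k1 : (lebesgue2 R).-integrable D (EFin \o I1) := i1.
have k2 : (lebesgue2 R).-integrable D (EFin \o I2) := i2.
have k3 : (lebesgue2 R).-integrable D (EFin \o I3) := i3.
have k4 : (lebesgue2 R).-integrable D (EFin \o I4) := i4.
have E1 : \int[lebesgue2 R]_(z in D) I1 z = PV := esym e1.
have E2 : \int[lebesgue2 R]_(z in D) I2 z = PV := esym e2.
have E3 : \int[lebesgue2 R]_(z in D) I3 z = PV := esym e3.
have E4 : \int[lebesgue2 R]_(z in D) I4 z = PV := esym e4.
pose S12 z := I1 z + I2 z.
pose S123 z := S12 z + I3 z.
pose S z := S123 z + I4 z.
have k12 : (lebesgue2 R).-integrable D (EFin \o S12) := integrableD mD k1 k2.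
have k123 : (lebesgue2 R).-integrable D (EFin \o S123) := integrableD mD k12 k3.
have k1234 : (lebesgue2 R).-integrable D (EFin \o S) := integrableD mD k123 k4.
have SE : \int[lebesgue2 R]_(z in D) S z = PV + PV + PV + PV.
  have t12 := RintegralD mD k1 k2; have t123 := RintegralD mD k12 k3.
  have t1234 := RintegralD mD k123 k4.
  apply: etrans t1234 _; apply: congr2 E4; apply: etrans t123 _; apply: congr2 E3.
  by apply: etrans t12 _; exact: congr2 E1 E2.
clearbody PV.
have -> : - 4 * PV = -1 * (PV + PV + PV + PV) by ring.
rewrite -SE; apply: etrans (esym (RintegralZl (-1) mD k1234)) _.
apply: eq_Rintegral => z _.
by rewrite /S /S123 /S12 /I1 /I2 /I3 /I4 /I /F /fd_g /=; ring.
Qed.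

Lemma pv_symmetrization p (e : R) : 0 < e ->
  \int[lebesgue2 R]_(y in [set y | e < enorm (p - y)]) pv_integrand p y =
  - \int[lebesgue2 R]_(z in [set z | e < enorm z] `&` [set z | 0 < z.1]
       `&` [set z | 0 < z.2]) F p z.
Proof.
move=> e0;
have n4 : (-4 : R) != 0 by rewrite oppr_eq0.
by apply: (mulfI n4); rewrite (pv_average p e0) (Rintegral_far_quadrant p e0) mulrNN.
Qed.

End principal_value.

(** * Removal of the cutoff in the principal value *)

Section quadrant_representation.
Context {R : realType}.
Variables (beta lam : R).
Hypotheses (beta02 : 0 < beta < 2) (lam0 : 0 <= lam).
Variables (u : R * R -> R) (M0 : R).
Hypotheses (cu : continuous u) (uM0 : forall z, `|u z| <= M0).
Variables (p : R * R) (B L : R).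
Hypotheses (L0 : 0 < L) (B0 : 0 <= B).
Hypothesis gB : forall z, 0 <= z.1 <= L -> 0 <= z.2 <= L ->
  `|fd_g u p z| <= B * enorm z ^+ 2.
Let RR := (measurableTypeR R * measurableTypeR R)%type.
Let F z := fd_g u p z * tempered_kernel beta lam z.
Let c0 := (1 - beta / 2) ^- 2.

Definition quadrant : set (R * R) := [set z | 0 < z.1] `&` [set z | 0 < z.2].

Lemma measurable_quadrant : measurable (quadrant : set RR).
Proof.
by apply: measurableI; [exact: measurable_halfplane_fst|exact: measurable_halfplane_snd].
Qed.

Let measurable_box (h : R) : measurable (`]0, h]%classic `*` `]0, h]%classic : set RR).
Proof. by apply: measurableX; exact: measurable_itv. Qed.

Let mF : measurable_fun setT F.
Proof. exact: measurable_fd_g_kernel. Qed.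

(** The quadratic bound on [fd_g] lowers the singularity from [2 + beta] to [beta < 2], which is
    integrable in the plane. *)
Let F_near z : 0 < z.1 <= L -> 0 < z.2 <= L -> `|F z| <= B * enorm z `^ (- beta).
Proof.
move=> /andP[x0 xL] /andP[y0 yL].
have r0 : 0 < enorm z by rewrite sqrtr_gt0 addr_gt0// exprn_gt0.
rewrite normrM (ger0_norm (tempered_kernel_ge0 _ _ _)).
have -> : B * enorm z `^ (- beta) = B * enorm z ^+ 2 * enorm z `^ (- (2 + beta)).
  rewrite -mulrA -powR_mulrn ?ltW// -powRD; last by rewrite (gt_eqF r0) implybT.
  by congr (_ * _ `^ _); lra.
by apply: ler_pM; rewrite ?normr_ge0 ?tempered_kernel_ge0 ?tempered_kernel_le ?gB ?(ltW x0) ?(ltW y0).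
Qed.

Let majorant_integral (h : R) : 0 < h ->
  (\int[lebesgue2 R]_(z in `]0%R, h] `*` `]0%R, h]) (B * enorm z `^ (- beta))%:E
    <= (B * (c0 * h `^ (2 - beta)))%:E)%E.
Proof.
move=> h0; under eq_integral do rewrite EFinM.
rewrite ge0_integralZl//.
- by rewrite EFinM; apply: lee_wpmul2l => //; exact: integral_enorm_near0.
- by apply: measurable_funTS; apply/measurable_EFinP; apply: measurable_fun_powR; exact: measurable_enorm.
- by move=> z _; rewrite lee_fin powR_ge0.
Qed.

Let measurable_majorant : measurable_fun setT (fun z : R * R => B * enorm z `^ (- beta)).
Proof. by apply: measurable_funM => //; apply: measurable_fun_powR; exact: measurable_enorm. Qed.

Lemma Rintegral_near0_le (D : set (R * R)) (h : R) : 0 < h <= L ->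
  measurable (D : set RR) -> D `<=` `]0, h]%classic `*` `]0, h]%classic ->
  `|\int[lebesgue2 R]_(z in D) F z| <= B * (c0 * h `^ (2 - beta)).
Proof.
move=> /andP[h0 hL] mD Dh.
apply: (@normr_Rintegral_le _ RR R (lebesgue2 R) _ F (fun z => B * enorm z `^ (- beta))) => //.
- move=> z /Dh[/=]; rewrite !in_itv/= => /andP[x0 xh] /andP[y0 yh].
  by apply: F_near; rewrite ?x0 ?y0/= (le_trans _ hL).
- apply: (integral_subset_le mD (measurable_box h) _ _ Dh) => //.
  + by move=> z; rewrite mulr_ge0 ?powR_ge0.
  + exact: majorant_integral.
Qed.

(** The quadrant is covered by the square of side [L], where [F_near] applies, and the region
    [L / 2 < |z|], where [u] bounded and the decay of the kernel suffice. *)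
Lemma integrable_quadrant : (lebesgue2 R).-integrable quadrant (EFin \o F).
Proof.
have mfar : measurable ([set z : R * R | L / 2 < enorm z] : set RR) by exact: measurable_enorm_gt.
have near : (lebesgue2 R).-integrable (`]0, L]%classic `*` `]0, L]%classic) (EFin \o F).
  apply: (@integrable_of_le _ RR R (lebesgue2 R) _ F (fun z => B * enorm z `^ (- beta))) => //.
  - by move=> z [/=]; rewrite !in_itv/=; exact: F_near.
  - apply/integrableP; split; first by apply: measurable_funTS; apply/measurable_EFinP.
    apply: le_lt_trans (ltry (B * (c0 * L `^ (2 - beta)))).
    apply: le_trans (majorant_integral L0).
    by under eq_integral => z _ do rewrite /= ger0_norm ?mulr_ge0 ?powR_ge0//.
have far : (lebesgue2 R).-integrable [set z | L / 2 < enorm z] (EFin \o F).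
  by apply: (integrable_fd_g_kernel_far beta02 lam0 cu uM0); rewrite divr_gt0.
apply: (integrableS _ measurable_quadrant _
  (integrable_setU (measurable_box L) mfar mF near far)).
- exact: measurableU.
- move=> [x y] [/= x0 y0].
  have [xL|xL] := leP x L; last first.
    right=> /=; apply: (@lt_le_trans _ _ x); first by move: L0; lra.
    exact: le_trans (ler_norm _) (enorm_fst (x, y)).
  have [yL|yL] := leP y L; last first.
    right=> /=; apply: (@lt_le_trans _ _ y); first by move: L0; lra.
    exact: le_trans (ler_norm _) (enorm_snd (x, y)).
  by left; split; rewrite /= in_itv/= ?x0 ?y0.
Qed.

(** After symmetrisation the difference is the integral over the part of the quadrant with
    [|z| <= e], which lies in the square of side [e]. *)
Lemma pv_dist_le (e : R) : 0 < e <= L ->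
  `|- (\int[lebesgue2 R]_(z in quadrant) F z)
    - \int[lebesgue2 R]_(y in [set y | e < enorm (p - y)])
        ((u p - u y) / (expR (lam * enorm (p - y)) * enorm (p - y) `^ (2 + beta)))|
  <= B * (c0 * e `^ (2 - beta)).
Proof.
move=> /andP[e0 eL]; rewrite (pv_symmetrization beta02 lam0 cu uM0)//.
have mfar : measurable ([set z : R * R | e < enorm z] : set RR) by exact: measurable_enorm_gt.
have mQ := measurable_quadrant.
rewrite -setIA -/quadrant setIC.
rewrite -{1}(setUIDK quadrant [set z | e < enorm z]) Rintegral_setU//; last 4 first.
- exact: measurableI.
- exact: measurableD.
- by rewrite setUIDK; exact: integrable_quadrant.
- by apply/disj_setPS => z [[_ ?] [_ ]].
have E (a b : R) : - (a + b) - - a = - b by ring.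
rewrite E normrN.
apply: Rintegral_near0_le; first by rewrite e0.
- exact: measurableD.
- move=> [x y] [[/= x0 y0] /negP]; rewrite -leNgt => xye.
  have := le_trans (enorm_fst (x, y)) xye; have := le_trans (enorm_snd (x, y)) xye.
  rewrite /= (ger0_norm (ltW x0)) (ger0_norm (ltW y0)) => h1 h2.
  by split; rewrite /= in_itv/= ?x0 ?y0.
Qed.

Lemma tempered_fraclapE (c : R) :
  tempered_fraclap c beta lam u p = c * \int[lebesgue2 R]_(z in quadrant) F z.
Proof.
rewrite /tempered_fraclap; set A := \int[lebesgue2 R]_(z in quadrant) F z.
suff -> : lim ((fun eps : R => \int[lebesgue2 R]_(y in [set y | eps < enorm (p - y)])
  ((u p - u y) / (expR (lam * enorm (p - y)) * enorm (p - y) `^ (2 + beta)))) @ 0^'+) = - A.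
  by rewrite mulrNN.
apply/cvg_lim => //; apply/cvgrPdist_le => d d0.
have b2 : 0 < 2 - beta by move: beta02; lra.
have := powR_cvg0 b2 => /cvgrPdist_le.
(* The added 1 keeps [k] positive when [B = 0], so that [d / k] is an admissible tolerance. *)
pose k := B * c0 + 1.
have c00 : 0 <= c0 by rewrite invr_ge0 sqr_ge0.
have k0 : 0 < k by rewrite ltr_wpDl// mulr_ge0.
move=> /(_ (d / k) (divr_gt0 d0 k0)) hk.
near=> e.
have e0 : 0 < e by near: e; exact: nbhs_right_gt.
have eL : e <= L by near: e; exact: nbhs_right_le.
have : `|0 - e `^ (2 - beta)| <= d / k by near: e.
rewrite sub0r normrN ger0_norm ?powR_ge0// ler_pdivlMr// => hd.
apply: (@le_trans _ _ (B * (c0 * e `^ (2 - beta)))).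
  by apply: pv_dist_le; rewrite e0.
apply: le_trans hd; rewrite mulrA [leRHS]mulrC ler_wpM2r ?powR_ge0//.
by rewrite /k lerDl.
Unshelve. all: by end_near. Qed.

End quadrant_representation.
(** * The discretization error *)

(** Comparison of the sum with the integral of [x ^ (- 1 - s)], carried out on its primitive by the
    mean value theorem. *)
Lemma sum_powR_le (R : realType) (s : R) (n : nat) : 0 < s ->
  \sum_(i < n) i.+1%:R `^ (- 1 - s) <= 1 + s^-1.
Proof.
move=> s0.
(* Keeping the tail [m.+1 ^ (- s) / s] makes the induction telescope. *)
suff H m : \sum_(i < m.+1) i.+1%:R `^ (- 1 - s) <= 1 + (1 - m.+1%:R `^ (- s)) / s.
  case: n => [|n]; first by rewrite big_ord0 addr_ge0// invr_ge0 ltW.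
  apply: le_trans (H n) _; rewrite lerD2l -[leRHS]mul1r ler_wpM2r ?invr_ge0 ?ltW//.
elim: m => [|m IHm].
  by rewrite big_ord_recl big_ord0 addr0 powR1 subrr mul0r addr0.
rewrite big_ord_recr/=; apply: le_trans (lerD IHm (lexx _)) _.
have m12 : m.+1%:R <= m.+2%:R :> R by rewrite ler_nat.
have pos (x : R) : m.+1%:R <= x <= m.+2%:R -> 0 < x.
  by move=> /andP[+ _]; apply: lt_le_trans.
have [x xm e] := MVT_closed m12 (fun x hx => is_derive1_powR (- s) (pos x hx)).
have x0 := pos x xm.
set A := m.+1%:R `^ (- s) in IHm e *; set B := m.+2%:R `^ (- s) in e *.
have h : m.+2%:R `^ (- 1 - s) <= (A - B) / s.
  rewrite ler_pdivlMr//.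
  have -> : A - B = s * x `^ (- s - 1).
    rewrite -[LHS]opprB e -natrB// subSnn mulr1; ring.
  rewrite mulrC ler_pM2l// [- 1 - s]addrC powR_le_npos//; last lra.
  by case/andP: xm.
apply: le_trans (lerD (lexx _) h) _.
by rewrite -addrA -mulrDl addrA subrK.
Qed.

(* [(i + 1) (j + 1) <= 4 max(i, j)^2] bounds the double sum by a product. *)
Lemma sum_max_powR_le (R : realType) (b : R) (n : nat) : 0 < b ->
  \sum_(i < n) \sum_(j < n | ~~ ((i == 0 :> nat) && (j == 0 :> nat)))
    (maxn i j)%:R `^ (- 2 - b) <= 4 `^ (1 + b / 2) * (1 + (b / 2)^-1) ^+ 2.
Proof.
move=> b0; pose s := b / 2; have s0 : 0 < s by rewrite divr_gt0.
pose w (i : nat) : R := i.+1%:R `^ (- 1 - s).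
have w0 i : 0 <= w i by exact: powR_ge0.
apply: (@le_trans _ _ (\sum_(i < n) \sum_(j < n) 4 `^ (1 + s) * (w i * w j))).
  apply: ler_sum => i _; rewrite big_mkcond/=; apply: ler_sum => j _.
  case: ifPn => [ij|_]; last by rewrite !mulr_ge0 ?powR_ge0.
  (* As [(0, 0)] is excluded, [m >= 1], whence [i + 1 <= 2 * m] and [j + 1 <= 2 * m]. *)
  set m := maxn i j.
  have m0 : (0 < m)%N.
    by rewrite lt0n -leqn0 geq_max !leqn0.
  have mi : (i <= m)%N by rewrite leq_maxl.
  have mj : (j <= m)%N by rewrite leq_maxr.
  clearbody m.
  have mR : (0 : R) < m%:R by rewrite ltr0n.
  rewrite /w -powRM//.
  have -> : 4 `^ (1 + s) = 4^-1 `^ (- 1 - s) :> R.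
    by rewrite -powR_inv1// -powRrM; congr powR; lra.
  rewrite -powRM ?mulr_ge0 ?invr_ge0//.
  have -> : m%:R `^ (- 2 - b) = (m%:R * m%:R) `^ (- 1 - s) :> R.
    rewrite powRM ?ler0n// -powRD; last by rewrite (gt_eqF mR) implybT.
    by congr powR; rewrite /s; lra.
  apply: powR_le_npos; last by lra.
    by rewrite !mulr_gt0 ?invr_gt0.
  rewrite -natrM -(@ler_pM2l _ 4)// mulrA divff// mul1r -!natrM ler_nat.
  nia.
under eq_bigr do rewrite -mulr_sumr -mulr_sumr.
rewrite -mulr_sumr ler_wpM2l ?powR_ge0//.
have S0 : 0 <= \sum_(j < n) w j by rewrite sumr_ge0.
under eq_bigr do rewrite mulrC.
rewrite -mulr_sumr expr2 ler_pM//; exact: sum_powR_le.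
Qed.

Lemma double_sum_split (V : zmodType) (a : nat -> nat -> V) (n : nat) :
  \sum_(i < n.+1) \sum_(j < n.+1) a i j = a 0%N 0%N +
  \sum_(i < n.+1) \sum_(j < n.+1 | ~~ ((i == 0 :> nat) && (j == 0 :> nat))) a i j.
Proof.
rewrite pair_big (bigD1 (ord0, ord0))//=; congr (_ + _).
rewrite pair_big_dep/=; apply: eq_bigl => -[i j] /=.
by rewrite xpair_eqE -!val_eqE.
Qed.

(** * Cell-by-cell comparison of the integral with the scheme *)

Section discretization_error.
Context {R : realType}.
Variables (beta gamma lam l : R) (u ux uxx uy uyy : R * R -> R) (M M0 : R).
Hypotheses (beta02 : 0 < beta < 2) (hgamma : beta < gamma <= 2).
Hypotheses (lam0 : 0 <= lam) (l0 : 0 < l) (M_ge0 : 0 <= M).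
Hypotheses (cu : continuous u) (uM0 : forall z, `|u z| <= M0).
Hypothesis supp : forall z, ~ Omega l z -> u z = 0.
Hypotheses
  (dx : forall x y : R, is_derive x 1 (fun t => u (t, y)) (ux (x, y)))
  (dxx : forall x y : R, is_derive x 1 (fun t => ux (t, y)) (uxx (x, y)))
  (dy : forall x y : R, is_derive y 1 (fun t => u (x, t)) (uy (x, y)))
  (dyy : forall x y : R, is_derive y 1 (fun t => uy (x, t)) (uyy (x, y))).
Hypotheses
  (uxxM : forall x y, - (3 * l) <= x <= 3 * l -> - (3 * l) <= y <= 3 * l ->
    `|uxx (x, y)| <= M)
  (uyyM : forall x y, - (3 * l) <= x <= 3 * l -> - (3 * l) <= y <= 3 * l ->
    `|uyy (x, y)| <= M).
Variable p : R * R.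
Hypotheses (p1l : - l < p.1 < l) (p2l : - l < p.2 < l).
Variables (N : nat) (h : R).
Hypotheses (h0 : 0 < h) (Nh : N%:R * h = 2 * l).

Let RR := (measurableTypeR R * measurableTypeR R)%type.
Let F z := fd_g u p z * tempered_kernel beta lam z.
Let phi := fd_phi gamma lam u p.
Let Lam := lam * (4 * l) + gamma.
Let C0 := 4 * M + 8 * M * Lam + 4 * M * (3 * Lam + Lam ^+ 2).
Let c0 := (1 - beta / 2) ^- 2.

Let gamma0 : 0 <= gamma.
Proof. by move: beta02 hgamma; lra. Qed.

Let Lam0 : 0 <= Lam.
Proof. by rewrite addr_ge0// mulr_ge0// mulr_ge0// ltW. Qed.

Let C00 : 0 <= C0.
Proof.
have a1 := mulr_ge0 M_ge0 Lam0; have a2 := mulr_ge0 M_ge0 (sqr_ge0 Lam).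
by rewrite /C0; move: M_ge0; lra.
Qed.

Let p1l' : - l <= p.1 <= l. Proof. by case/andP: p1l => *; rewrite !ltW. Qed.
Let p2l' : - l <= p.2 <= l. Proof. by case/andP: p2l => *; rewrite !ltW. Qed.

Let gB z : 0 <= z.1 <= 2 * l -> 0 <= z.2 <= 2 * l ->
  `|fd_g u p z| <= 4 * M * enorm z ^+ 2.
Proof. exact: (fd_g_le l0 dx dxx dy dyy uxxM uyyM p1l' p2l'). Qed.

Let B0 : 0 <= 4 * M. Proof. by rewrite mulr_ge0. Qed.

Let L0 : 0 < 2 * l. Proof. by rewrite mulr_gt0. Qed.

Let iQ : (lebesgue2 R).-integrable quadrant (EFin \o F).
Proof. exact: (integrable_quadrant beta02 lam0 cu uM0 L0 B0 gB). Qed.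

Let mF : measurable_fun setT F.
Proof. exact: measurable_fd_g_kernel. Qed.

Lemma fd_weightE z : fd_weight beta gamma z = enorm z `^ (gamma - 2 - beta).
Proof. by rewrite enorm_powR. Qed.

Lemma measurable_fd_weight : measurable_fun setT (fd_weight beta gamma : R * R -> R).
Proof.
rewrite (_ : fd_weight beta gamma = (fun z => enorm z `^ (gamma - 2 - beta))).
  by apply: measurable_fun_powR; exact: measurable_enorm.
by apply/funext => z; exact: fd_weightE.
Qed.

Lemma measurable_bilinear_interp (f : R * R -> R) (a b c d : R) :
  measurable_fun setT (bilinear_interp f a b c d).
Proof.
apply: measurable_funM => //.
do ?[apply: measurable_funD];
  apply: measurable_funM; try (apply: measurable_funM => //); by apply: measurable_funB.
Qed.

Let nodeS i : fd_node h i.+1 = fd_node h i + h.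
Proof. by rewrite /fd_node -natr1 mulrDl mul1r. Qed.

Let node_diff i : fd_node h i.+1 - fd_node h i = h.
Proof. by rewrite nodeS addrAC subrr add0r. Qed.

Let node_ge0 i : 0 <= fd_node h i.
Proof. by rewrite /fd_node mulr_ge0// ltW. Qed.

Let node_le i : (i < N)%N -> fd_node h i.+1 <= 2 * l.
Proof. by move=> iN; rewrite -Nh /fd_node ler_pM2r// ler_nat. Qed.

Let cell i j : set (R * R) :=
  `]fd_node h i, fd_node h i.+1]%classic `*` `]fd_node h j, fd_node h j.+1]%classic.

Let measurable_cell i j : measurable (cell i j : set RR).
Proof. by apply: measurableX; exact: measurable_itv. Qed.

Let cell_quadrant i j : cell i j `<=` quadrant.
Proof.
move=> [x y] [/=]; rewrite !in_itv/= => /andP[hx _] /andP[hy _].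
by split=> /=; [exact: le_lt_trans hx|exact: le_lt_trans hy].
Qed.

Let F_phi z : 0 < enorm z -> F z = phi z * fd_weight beta gamma z.
Proof.
move=> r0; rewrite fd_weightE /phi fd_phiE /F tempered_kernelE -!mulrA.
rewrite -powRD; last by rewrite (gt_eqF r0) implybT.
by congr (_ * (_ * powR _ _)); ring.
Qed.

Lemma fd_cell_error (i j : nat) : (i < N)%N -> (j < N)%N ->
  ~~ ((i == 0) && (j == 0))%N ->
  `|\int[lebesgue2 R]_(z in cell i j) F z - fd_I beta gamma lam h u p i j|
  <= 2 * C0 * h `^ (2 - beta) * (maxn i j)%:R `^ (- 2 - beta).
Proof.
move=> iN jN ij; set m := maxn i j.
have m0 : (0 < m)%N by rewrite lt0n -leqn0 geq_max !leqn0.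
(* The coordinate with the larger index is at least [h * m] on the whole cell, so [rho] bounds [|z|]
   from below. *)
pose rho := h * m%:R.
have rho0 : 0 < rho by rewrite mulr_gt0// ltr0n.
have rho_le s t : fd_node h i <= s -> fd_node h j <= t -> rho <= enorm (s, t).
  move=> hs ht; rewrite /rho mulrC /m /maxn; case: ifP => _.
  - by apply: le_trans (enorm_snd (s, t)); apply: le_trans ht _; exact: ler_norm.
  - by apply: le_trans (enorm_fst (s, t)); apply: le_trans hs _; exact: ler_norm.
pose P := bilinear_interp phi (fd_node h i) (fd_node h i.+1) (fd_node h j) (fd_node h j.+1).
pose D z := F z - P z * fd_weight beta gamma z.
(* Interpolation error in both directions times the largest value of the weight, whose exponent is
   nonpositive because [gamma <= 2]. *)
pose k := 2 * C0 * rho `^ (- gamma) * h ^+ 2 * rho `^ (gamma - 2 - beta).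
have mPw : measurable_fun setT (fun z => P z * fd_weight beta gamma z).
  by apply: measurable_funM; [exact: measurable_bilinear_interp|exact: measurable_fd_weight].
have mD : measurable_fun setT D by exact: measurable_funB.
have ni : fd_node h i < fd_node h i.+1 by rewrite nodeS ltrDl.
have nj : fd_node h j < fd_node h j.+1 by rewrite nodeS ltrDl.
have D_le z : cell i j z -> `|D z| <= k.
  case: z => s t [/=]; rewrite !in_itv/= => /andP[s1 s2] /andP[t1 t2].
  have rst := rho_le s t (ltW s1) (ltW t1).
  rewrite /D F_phi; last exact: lt_le_trans rst.
  rewrite -mulrBl normrM [X in _ * X]ger0_norm ?powR_ge0//.
  have sI : fd_node h i <= s <= fd_node h i.+1 by rewrite ltW.
  have tI : fd_node h j <= t <= fd_node h j.+1 by rewrite ltW.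
  have := fd_phi_interp_error l0 dx dxx dy dyy uxxM uyyM lam0 gamma0 p1l' p2l'
    (node_ge0 i) ni (node_le iN) (node_ge0 j) nj (node_le jN) rho0
    (fun s t hs ht => rho_le s t (proj1 (andP hs)) (proj1 (andP ht))) sI tI.
  rewrite -/phi -/P -/Lam -/C0 !node_diff => hP.
  apply: ler_pM => //; first exact: powR_ge0.
    by apply: le_trans hP _; rewrite le_eqVlt; apply/predU1P; left; ring.
  rewrite fd_weightE powR_le_npos//; move: beta02 hgamma; lra.
have mu_cell : (lebesgue2 R) (cell i j) = (h ^+ 2)%:E.
  rewrite product_measure1E; [|exact: measurable_itv|exact: measurable_itv].
  have -> : (h ^+ 2)%:E = (h%:E * h%:E)%E by rewrite -EFinM.
  by congr (_ * _)%E; rewrite -[LHS]/(lebesgue_measure _) lebesgue_measure_itv/= lte_fin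
    ?ni ?nj -EFinB node_diff.
have ik : (\int[lebesgue2 R]_(z in cell i j) (cst k z)%:E <= (k * h ^+ 2)%:E)%E.
  rewrite (_ : (fun z => (cst k z)%:E) = cst k%:E)//.
  by rewrite integral_cst//= -/(cell i j) [X in (_ * X)%E]mu_cell -EFinM.
have k0 : 0 <= k.
  by rewrite mulr_ge0 ?powR_ge0// mulr_ge0 ?sqr_ge0// mulr_ge0 ?powR_ge0// mulr_ge0.
have iD : (lebesgue2 R).-integrable (cell i j) (EFin \o D).
  apply: (@integrable_of_le _ RR R (lebesgue2 R) _ D (cst k)) => //.
  apply/integrableP; split; first by apply/measurable_EFinP; exact: measurable_cst.
  apply: le_lt_trans (ltry (k * h ^+ 2)); apply: le_trans ik.
  by under eq_integral => z _ do rewrite /= ger0_norm//.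
have iFc : (lebesgue2 R).-integrable (cell i j) (EFin \o F).
  exact: (integrableS measurable_quadrant (measurable_cell i j) (@cell_quadrant i j) iQ).
(* The interpolated integrand is recovered as [F - D], both integrable on the cell, so its integral
   splits. *)
have e1 : fd_I beta gamma lam h u p i j = \int[lebesgue2 R]_(z in cell i j) F z
    - \int[lebesgue2 R]_(z in cell i j) D z.
  rewrite /fd_I Rintegral_closed_cell//.
  apply: etrans (RintegralB (measurable_cell i j) iFc iD).
  by apply: eq_Rintegral => z _; rewrite /D opprB addrC subrK.
rewrite e1 opprB addrC subrK.
apply: le_trans (@normr_Rintegral_le _ RR R (lebesgue2 R) _ D (cst k) _
  (measurable_cell i j) mD (measurable_cst _) D_le ik) _.
rewrite le_eqVlt; apply/predU1P; left.
have mR : (0 : R) < m%:R by rewrite ltr0n.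
have -> : k * h ^+ 2 = 2 * C0 * (rho `^ (- gamma) * rho `^ (gamma - 2 - beta)) * (h ^+ 2 * h ^+ 2).
  by rewrite /k; ring.
rewrite -powRD; last by rewrite (gt_eqF rho0) implybT.
(* Here [gamma] cancels, so the order of convergence does not depend on it. *)
have -> : - gamma + (gamma - 2 - beta) = - 2 - beta by ring.
rewrite /rho powRM ?ler0n ?(ltW h0)//.
have -> : h `^ (2 - beta) = h `^ (- 2 - beta) * (h ^+ 2 * h ^+ 2).
  rewrite -exprD -powR_mulrn ?(ltW h0)// -powRD; last by rewrite (gt_eqF h0) implybT.
  by congr powR; ring.
ring.
Qed.

Hypothesis N0 : (0 < N)%N.

Let h_le : h <= 2 * l.
Proof. by rewrite -Nh ler_peMl ?(ltW h0)// ler1n. Qed.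

Let node0 : fd_node h 0 = 0. Proof. by rewrite /fd_node mul0r. Qed.
Let node1 : fd_node h 1 = h. Proof. by rewrite /fd_node mul1r. Qed.

(** [fd_g_le] leaves the power [2 - gamma >= 0] of the norm, which is increasing; [2 * h] is a crude
    bound for the diagonal of the cell. *)
Let phi_corner_le (s t : R) : 0 <= s <= h -> 0 <= t <= h -> 0 < enorm (s, t) ->
  `|phi (s, t)| <= 4 * M * (2 * h) `^ (2 - gamma).
Proof.
move=> sh th r0.
have s2 : 0 <= s <= 2 * l by case/andP: sh => -> /= sh; exact: le_trans h_le.
have t2 : 0 <= t <= 2 * l by case/andP: th => -> /= th; exact: le_trans h_le.
have rh : enorm (s, t) <= 2 * h.
  rewrite -(@ler_pXn2r _ 2) ?nnegrE ?enorm_ge0//; last by rewrite mulr_ge0// ltW.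
  have s2h : s ^+ 2 <= h ^+ 2.
    by case/andP: sh => ? ?; rewrite lerXn2r ?nnegrE// ltW.
  have t2h : t ^+ 2 <= h ^+ 2.
    by case/andP: th => ? ?; rewrite lerXn2r ?nnegrE// ltW.
  have := sqr_ge0 h; rewrite sqr_enorm/= exprMn; move: s2h t2h; lra.
rewrite /phi fd_phiE normrM [X in _ * X]ger0_norm; last first.
  by rewrite mulr_ge0 ?expR_ge0 ?powR_ge0.
apply: (@le_trans _ _ (4 * M * enorm (s, t) ^+ 2 * enorm (s, t) `^ (- gamma))).
  apply: ler_pM; [exact: normr_ge0|by rewrite mulr_ge0 ?expR_ge0 ?powR_ge0|exact: gB|].
  rewrite ler_piMl ?powR_ge0// -expR0 ler_expR oppr_le0.
  by rewrite mulr_ge0// ltW.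
rewrite -mulrA -powR_mulrn ?(ltW r0)// -powRD; last by rewrite (gt_eqF r0) implybT.
rewrite ler_wpM2l// ge0_ler_powR ?nnegrE ?(ltW r0)//; last by rewrite mulr_ge0// ltW.
by move: hgamma; lra.
Qed.

Let G00_le : `|fd_G00 beta gamma h| <=
  ((gamma - beta) / 2) ^- 2 * h `^ (gamma - beta).
Proof.
rewrite /fd_G00 Rintegral_closed_cell; last exact: measurable_fd_weight.
(* Minus the exponent of the weight: it is positive by [gamma <= 2] and below 2, hence integrable,
   by [beta < gamma]. *)
have b02 : 0 < 2 + beta - gamma < 2 by move: beta02 hgamma; lra.
have := integral_enorm_near0 b02 h0.
have -> : 1 - (2 + beta - gamma) / 2 = (gamma - beta) / 2 by field.
have -> : 2 - (2 + beta - gamma) = gamma - beta by ring.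
apply: (@normr_Rintegral_le _ RR R (lebesgue2 R) _ (fd_weight beta gamma)).
- by apply: measurableX; exact: measurable_itv.
- exact: measurable_fd_weight.
- by apply: measurable_fun_powR; exact: measurable_enorm.
- move=> z _; rewrite fd_weightE ger0_norm ?powR_ge0//.
  by rewrite (_ : gamma - 2 - beta = - (2 + beta - gamma)); last ring.
Qed.

(** The bound [1 / 3], attained for [gamma = 2], offsets the three corner values that are added
    up. *)
Let fd_k4_le : 0 <= fd_k gamma / 4 <= 3^-1.
Proof. by rewrite /fd_k; case: ifP => _; lra. Qed.

Let C1 := 4 * M * c0 + 4 * M * 2 `^ (2 - gamma) * ((gamma - beta) / 2) ^- 2.

Lemma fd_near_error :
  `|\int[lebesgue2 R]_(z in `]0, h] `*` `]0, h]) F z -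
    fd_k gamma / 4 * (phi (fd_node h 0, fd_node h 1) + phi (fd_node h 1, fd_node h 1)
      + phi (fd_node h 1, fd_node h 0)) * fd_G00 beta gamma h|
  <= C1 * h `^ (2 - beta).
Proof.
apply: le_trans (ler_normB _ _) _; rewrite mulrDl; apply: lerD.
  rewrite -mulrA.
  apply: (Rintegral_near0_le beta02 lam0 cu B0 gB) => //; first by rewrite h0.
  by apply: measurableX; exact: measurable_itv.
rewrite node0 node1 normrM.
have hh : 0 <= h <= h by rewrite lexx ltW.
have h00 : (0 : R) <= 0 <= h by rewrite lexx ltW.
have r1 : 0 < enorm (0, h) by rewrite sqrtr_gt0/= expr0n/= add0r exprn_gt0.
have r2 : 0 < enorm (h, h) by rewrite sqrtr_gt0/= addr_gt0// exprn_gt0.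
have r3 : 0 < enorm (h, 0) by rewrite sqrtr_gt0/= expr0n/= addr0 exprn_gt0.
have q1 := phi_corner_le h00 hh r1.
have q2 := phi_corner_le hh hh r2.
have q3 := phi_corner_le hh h00 r3.
pose X := 4 * M * (2 * h) `^ (2 - gamma).
have X0 : 0 <= X by rewrite mulr_ge0// powR_ge0.
apply: (@le_trans _ _ (X * (((gamma - beta) / 2) ^- 2 * h `^ (gamma - beta)))).
  apply: ler_pM => //; rewrite normrM.
  have [k0 k4] := andP fd_k4_le.
  rewrite (ger0_norm k0).
  have -> : X = 3^-1 * (X + X + X) by field.
  apply: ler_pM => //.
  apply: le_trans (ler_normD _ _) _; apply: lerD q3.
  exact: le_trans (ler_normD _ _) (lerD q1 q2).
rewrite le_eqVlt; apply/predU1P; left.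
rewrite /X powRM// ?(ltW h0)//.
have -> : h `^ (2 - beta) = h `^ (2 - gamma) * h `^ (gamma - beta).
  by rewrite -powRD; [congr powR; ring|rewrite (gt_eqF h0) implybT].
ring.
Qed.

Let supp0 x y : ~~ (- l < x < l) || ~~ (- l < y < l) -> u (x, y) = 0.
Proof.
move=> xy; apply: supp => -[/=]; rewrite !in_itv/= => hx hy.
by move: xy; rewrite hx hy.
Qed.

(** A coordinate above [2 * l], the width of Omega, moves all four reflected points out of Omega. *)
Let fd_g_outside z : quadrant z -> ~ (`]0, 2 * l]%classic `*` `]0, 2 * l]%classic) z ->
  fd_g u p z = - 4 * u p.
Proof.
case: z => x y [/= x0 y0] nz.
have /orP[xl|yl] : (2 * l < x) || (2 * l < y).
  rewrite !ltNge -negb_and; apply/negP => /andP[xl yl]; apply: nz.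
  by split; rewrite /= in_itv/= ?x0 ?y0.
- have o1 : ~~ (- l < p.1 + x < l) by move: p1l; lra.
  have o2 : ~~ (- l < p.1 - x < l) by move: p1l; lra.
  by rewrite /fd_g/= !supp0 ?o1 ?o2//; ring.
- have o1 : ~~ (- l < p.2 + y < l) by move: p2l; lra.
  have o2 : ~~ (- l < p.2 - y < l) by move: p2l; lra.
  by rewrite /fd_g/= !supp0 ?o1 ?o2 ?orbT//; ring.
Qed.

Lemma fd_far_exact :
  \int[lebesgue2 R]_(z in quadrant `\` (`]0, 2 * l]%classic `*` `]0, 2 * l]%classic)) F z =
  - 4 * u p * fd_Ginfty beta lam (2 * l).
Proof.
set S := `]0, 2 * l]%classic `*` `]0, 2 * l]%classic.
have mQ : measurable (quadrant : set RR) := @measurable_quadrant R.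
have mS : measurable (S : set RR) by apply: measurableX; exact: measurable_itv.
have mQS : measurable (quadrant `\` S : set RR) by exact: measurableD.
have mT : measurable ([set z : R * R | l < enorm z] : set RR) := measurable_enorm_gt l.
have sub : quadrant `\` S `<=` [set z | l < enorm z].
  move=> [x y] [[/= x0 y0] nz]; rewrite ltNge; apply/negP => rl; apply: nz.
  have := le_trans (enorm_fst (x, y)) rl; have := le_trans (enorm_snd (x, y)) rl.
  rewrite /= (ger0_norm (ltW x0)) (ger0_norm (ltW y0)) => hy hx.
  have ll : l <= 2 * l by move: l0; lra.
  by split; rewrite /= in_itv/= ?x0 ?y0/=; [exact: le_trans ll|exact: le_trans ll].
have iK := integrableS mT mQS sub (integrable_tempered_kernel_far beta02 lam0 l0).
have -> : fd_Ginfty beta lam (2 * l) =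
    \int[lebesgue2 R]_(z in quadrant `\` S) tempered_kernel beta lam z.
  rewrite /fd_Ginfty.
  rewrite (_ : (fun q => 1 / _) = tempered_kernel beta lam); last first.
    by apply/funext => z; rewrite div1r.
  (* [fd_Ginfty] uses the closed quadrant and the closed square; the two domains agree off the
     axes. *)
  apply: (@Rintegral_mod_lines R 0 0).
  - apply: measurableD; apply: measurableX; exact: measurable_itv.
  - exact: mQS.
  - exact: measurable_tempered_kernel.
  - move=> [x y] /= x0 y0.
    have ex : (0 < x) = (0 <= x) by rewrite lt_neqAle eq_sym (introF eqP x0).
    have ey : (0 < y) = (0 <= y) by rewrite lt_neqAle eq_sym (introF eqP y0).
    by rewrite /quadrant /S /= !in_itv/= !andbT ex ey.
apply: etrans (RintegralZl (- 4 * u p) mQS iK).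
by apply: eq_Rintegral => z; rewrite inE => -[Qz nSz]; rewrite /F fd_g_outside.
Qed.

Let S0 := 4 `^ (1 + beta / 2) * (1 + (beta / 2)^-1) ^+ 2.

Lemma fd_error (c : R) : 0 < c -> h = 2 * l / N%:R ->
  `|tempered_fraclap c beta lam u p - fd_tempered_fraclap c beta gamma lam l N u p|
  <= c * (C1 + 2 * C0 * S0) * h `^ (2 - beta).
Proof.
move=> c_gt0 hE.
rewrite (tempered_fraclapE beta02 lam0 cu uM0 L0 B0 gB).
rewrite /fd_tempered_fraclap -hE -/phi.
rewrite -mulrBr normrM (gtr0_norm c_gt0) -[leRHS]mulrA ler_pM2l//.
set S := `]0, 2 * l]%classic `*` `]0, 2 * l]%classic.
have mQ : measurable (quadrant : set RR) := @measurable_quadrant R.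
have mS : measurable (S : set RR) by apply: measurableX; exact: measurable_itv.
have mQS : measurable (quadrant `\` S : set RR) by exact: measurableD.
have subS : S `<=` quadrant.
  by move=> [x y] [/=]; rewrite !in_itv/= => /andP[? _] /andP[? _].
have iS := integrableS mQ mS subS iQ.
have eQ : \int[lebesgue2 R]_(z in quadrant) F z =
    \int[lebesgue2 R]_(z in S) F z - 4 * u p * fd_Ginfty beta lam (2 * l).
  have SQ : S `|` (quadrant `\` S) = quadrant by exact: setDUK.
  have iSQ : (lebesgue2 R).-integrable (S `|` (quadrant `\` S)) (EFin \o F).
    by rewrite SQ.
  have dS : [disjoint S & quadrant `\` S] by apply/disj_setPS => z [? []].
  have := Rintegral_setU mS mQS iSQ dS; rewrite SQ fd_far_exact => ->.
  by rewrite !mulNr.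
have eS : \int[lebesgue2 R]_(z in S) F z =
   \int[lebesgue2 R]_(z in `]0, h] `*` `]0, h]) F z +
   \sum_(i < N) \sum_(j < N | ~~ ((i == 0 :> nat) && (j == 0 :> nat)))
     \int[lebesgue2 R]_(z in cell i j) F z.
  have nd : nondecreasing_seq (fd_node h).
    by move=> i j ij; rewrite /fd_node ler_pM2r// ler_nat.
  have SE : S = `]fd_node h 0, fd_node h N]%classic `*` `]fd_node h 0, fd_node h N]%classic.
    by rewrite /S node0 /fd_node Nh.
  have iG : (lebesgue2 R).-integrable
      (`]fd_node h 0%N, fd_node h N]%classic `*` `]fd_node h 0%N, fd_node h N]%classic) (EFin \o F).
    by rewrite -SE.
  rewrite SE (Rintegral_grid nd iG).
  have -> : `]0, h]%classic `*` `]0, h]%classic = cell 0 0 by rewrite /cell node0 node1.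
  case: N N0 => [//|n] _.
  exact: (double_sum_split (fun i j => \int[lebesgue2 R]_(z in cell i j) F z)).
rewrite eQ eS.
(* The far contributions, here [e], cancel; what remains is the origin cell and the other cells. *)
have E (a b c' d e : R) : a + b - e - (c' + d - e) = (a - c') + (b - d) by ring.
rewrite E; apply: le_trans (ler_normD _ _) _.
rewrite mulrDl; apply: lerD; first exact: fd_near_error.
rewrite -sumrB; under eq_bigr do rewrite -sumrB.
apply: (@le_trans _ _ (\sum_(i < N) \sum_(j < N | ~~ ((i == 0 :> nat) && (j == 0 :> nat)))
    (2 * C0 * h `^ (2 - beta)) * (maxn i j)%:R `^ (- 2 - beta))).
  apply: le_trans (ler_norm_sum _ _ _) _; apply: ler_sum => i _.
  apply: le_trans (ler_norm_sum _ _ _) _; apply: ler_sum => j ij.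
  exact: fd_cell_error.
under eq_bigr do rewrite -mulr_sumr.
rewrite -mulr_sumr.
have -> : 2 * C0 * S0 * h `^ (2 - beta) = 2 * C0 * h `^ (2 - beta) * S0 by ring.
rewrite ler_wpM2l//; first by rewrite mulr_ge0 ?powR_ge0// mulr_ge0.
by apply: sum_max_powR_le; case/andP: beta02.
Qed.

End discretization_error.
Lemma compactly_supported_bounded (R : realType) (u : R * R -> R) (l : R) :
  0 < l -> continuous u -> (forall p, ~ Omega l p -> u p = 0) ->
  exists M, forall p, `|u p| <= M.
Proof.
move=> l0 cu supp.
have [M M_ge0 uM] := continuous_bounded_on_square (ltW l0) cu.
exists M => -[x y]; have [[/=]|nO] := pselect (Omega l (x, y)); last first.
  by rewrite supp// normr0.
rewrite !in_itv/= => /andP[x1 x2] /andP[y1 y2].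
by apply: uM; rewrite !ltW.
Qed.

Unset Implicit Arguments.

Theorem theorem2p1 (R : realType) (beta gamma lambda l c : R) (u : R * R -> R)
    (hbeta : 0 < beta < 2) (hgamma : beta < gamma <= 2) (hlambda : 0 <= lambda)
    (hl : 0 < l) (hc : is_tempered_constant beta lambda c)
    (hu : of_class_C 2 u) (hsupp : forall p, ~ Omega l p -> u p = 0) :
  exists C : R, 0 < C /\
    forall N : nat, (1 <= N)%N ->
      (sup_norm (Omega l)
         (fun p => (tempered_fraclap c beta lambda u p
                   - fd_tempered_fraclap c beta gamma lambda l N u p)%R)
       <= (C * (2 * l / N%:R) `^ (2 - beta))%R%:E)%E.
Proof.
have l0 := hl.
have [c_gt0 _ _] := hc.
have cu : continuous u by case: hu.
have [ux [uxx [uy [uyy [M [M_ge0 [dx dxx] [dy dyy] uxxM uyyM]]]]]] :=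
  of_class_C2_partials l0 hu.
have [M0 uM0] := compactly_supported_bounded l0 cu hsupp.
pose Lam := lambda * (4 * l) + gamma.
pose C0 := 4 * M + 8 * M * Lam + 4 * M * (3 * Lam + Lam ^+ 2).
pose C1 := 4 * M * (1 - beta / 2) ^- 2
  + 4 * M * 2 `^ (2 - gamma) * ((gamma - beta) / 2) ^- 2.
pose S0 : R := 4 `^ (1 + beta / 2) * (1 + (beta / 2)^-1) ^+ 2.
(* The bare constant may vanish, for instance when [M = 0]; adding 1 to its absolute value makes it
   positive. *)
exists (`|c * (C1 + 2 * C0 * S0)| + 1); split; first by rewrite ltr_wpDl.
move=> N N0; apply: ge_ereal_sup => _ [p [/= p1 p2] <-].
move: p1 p2; rewrite !in_itv/= => p1 p2.
rewrite lee_fin.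
have h0 : 0 < 2 * l / N%:R by rewrite divr_gt0 ?mulr_gt0 ?ltr0n.
have Nh : N%:R * (2 * l / N%:R) = 2 * l.
  by rewrite mulrC divfK// pnatr_eq0 -lt0n.
apply: le_trans (fd_error hbeta hgamma hlambda l0 M_ge0 cu uM0 hsupp
  dx dxx dy dyy uxxM uyyM p1 p2 h0 Nh N0 c_gt0 erefl) _.
rewrite ler_wpM2r ?powR_ge0//; apply: le_trans (ler_norm _) _.
by rewrite lerDl.
Qed.
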